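(* Let $(a_n)_{n=1}^\infty$ be an $L^2$-good universal sequence of natural numbers such that $(a_n\theta)_{n=1}^\infty$ is uniformly distributed modulo $1$ for every irrational number $\theta$. Then for $\mu$-almost every $\alpha\in B(0,1)$, $$\lim_{n\to\infty}\frac1n\sum_{j=1}^n\big(-\mathfrak{v}(c_{a_j}(\alpha))\big)=\frac{p^f}{(p^f-1)e}.$$
   Context: Let $p$ be a prime and let $K$ be a finite extension of $\mathbb{Q}_p$ of degree $m$, with ramification index $e$ and residue degree $f$ (so $m=ef$). Let $|\cdot|$ be the unique extension to $K$ of the $p$-adic absolute value with $|p|=p^{-1}$, and let $\mathfrak{v}$ be the valuation on $K^*$ with $|x|=p^{-\mathfrak{v}(x)}$. Let $L\subseteq K$ be the unramified subextension of degree $f$ over $\mathbb{Q}_p$, write $L=\mathbb{Q}_p(\gamma)$ with $\gamma$ a primitive $(p^f-1)$-th root of unity, and fix $\beta\in K$ with $K=L(\beta)$ and $|\beta|=p^{1/e}$. For $b=\sum_{j\ge n_0}a_jp^j\in\mathbb{Q}_p$ with digits $a_j\in\{0,1,\dots,p-1\}$ put $\lfloor b\rfloor_p=\sum_{n_0\le j\le 0}a_jp^j$ (which is $0$ if $|b|<1$). Every $\alpha\in K$ is uniquely $\alpha=\sum_{i=0}^{e-1}\sum_{j=0}^{f-1}b_{i,j}\gamma^j\beta^i$ with $b_{i,j}\in\mathbb{Q}_p$, and $\lfloor\alpha\rfloor=\sum_{i=0}^{e-1}\sum_{j=0}^{f-1}\lfloor b_{i,j}\rfloor_p\gamma^j\beta^i$.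 Let $B(0,1)=\{x\in K:|x|<1\}$, and let $\mu$ be the restriction to $B(0,1)$ (with its Borel $\sigma$-algebra) of the Haar measure of the additive group $K$, normalized by $\mu(B(0,1))=1$. The continued fraction map $T:B(0,1)\to B(0,1)$ is $T(\alpha)=\frac1\alpha-\left\lfloor\frac1\alpha\right\rfloor$ for $\alpha\ne 0$ and $T(0)=0$. The $n$-th partial quotient of $\alpha\in B(0,1)$ is $c_n(\alpha)=\lfloor 1/T^{n-1}(\alpha)\rfloor$ for $n\ge 1$, defined when $T^{n-1}(\alpha)\neq 0$ (so all $c_n(\alpha)$ are defined for $\mu$-almost every $\alpha$). A strictly increasing sequence of positive integers $(a_n)_{n\ge1}$ is $L^2$-good universal if for each measure-preserving dynamical system $(X,\mathcal{C},\nu,S)$ on a probability space and each $g\in L^2(X,\mathcal{C},\nu)$ the limit $\lim_{n\to\infty}\frac1n\sum_{j=1}^n g(S^{a_j-1}x)$ exists for $\nu$-almost every $x$. A real sequence $(x_n)_{n\ge1}$ is uniformly distributed modulo $1$ if for each interval $I\subseteq[0,1)$, $\lim_{n\to\infty}\frac1n\#\{1\le j\le n:\{x_j\}\in I\}$ equals the length of $I$, where $\{x_j\}$ is the fractional part. *)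

(* Defs.v *)
From HB Require Import structures.
From mathcomp Require Import all_boot all_order all_algebra all_field.
From mathcomp Require Import all_classical all_reals all_analysis.

Set Implicit Arguments.
Unset Strict Implicit.
Unset Printing Implicit Defensive.

Import Order.TTheory GRing.Theory Num.Theory numFieldNormedType.Exports.

Local Open Scope classical_set_scope.
Local Open Scope ring_scope.

Definition is_absval (R : realType) (F : fieldType) (abs : F -> R) : Prop :=
  [/\ forall x, 0 <= abs x,
      forall x, abs x = 0 <-> x = 0,
      forall x y, abs (x * y) = abs x * abs y
    & forall x y, abs (x + y) <= abs x + abs y].

Definition padic_abs_rat (R : realType) (p : nat) (q : rat) : R :=
  if q == 0 then 0
  else p%:R ^ ((logn p `|denq q|)%:Z - (logn p `|numq q|)%:Z).

(* (Qp, abs) is a completion of the rationals for the p-adic absolute value;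
   this determines (Qp, abs) up to a unique isometric isomorphism. *)
Definition is_padic_completion (R : realType) (p : nat) (Qp : fieldType)
    (abs : Qp -> R) : Prop :=
  [/\ is_absval abs,
      forall q : rat, abs (ratr q) = padic_abs_rat R p q,
      forall (x : Qp) (eps : R), 0 < eps ->
        exists q : rat, abs (x - ratr q) < eps
    & forall u : nat -> Qp,
        (forall eps : R, 0 < eps -> exists N, forall m n : nat,
           (N <= m)%N -> (N <= n)%N -> abs (u m - u n) < eps) ->
        exists x : Qp, (fun n => abs (u n - x)) @ \oo --> (0 : R)].

(* The index of the subgroup |Qp^*| in |E^*| is e: there are exactly e cosets
   |x| |Qp^*| with x in E^*. *)
Definition ramification_index (R : realType) (Qp : fieldType)
    (K : fieldExtType Qp) (absK : K -> R) (E : {subfield K}) (e : nat) : Prop :=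
  ([set [set absK (x * a%:A) | a in [set a : Qp | a != 0]]
     | x in [set x : K | (x \in E) && (x != 0)]] #= `I_e)%card.

(* The residue field of E has dimension f over the residue field of Qp: the
   classes of u_0, ..., u_(f-1) modulo the maximal ideal form a basis. *)
Definition residue_degree (R : realType) (Qp : fieldType) (absp : Qp -> R)
    (K : fieldExtType Qp) (absK : K -> R) (E : {subfield K}) (f : nat) : Prop :=
  exists u : 'I_f -> K,
    [/\ forall i, u i \in E /\ absK (u i) <= 1,
        forall x, x \in E -> absK x <= 1 ->
          exists a : 'I_f -> Qp, (forall i, absp (a i) <= 1) /\
            absK (x - \sum_(i < f) a i *: u i) < 1
      & forall a : 'I_f -> Qp, (forall i, absp (a i) <= 1) ->
          absK (\sum_(i < f) a i *: u i) < 1 -> forall i, absp (a i) < 1].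

(* a k is the digit of b at p^(k - N); leading zeros are allowed, so every b
   has such an expansion for all large N. *)
Definition padic_expansion (R : realType) (p : nat) (Qp : fieldType)
    (absp : Qp -> R) (b : Qp) (N : nat) (a : nat -> nat) : Prop :=
  (forall k, (a k < p)%N) /\
  (fun n => absp (b - \sum_(k < n) (a k)%:R * p%:R ^ (k%:Z - N%:Z)))
    @ \oo --> (0 : R).

(* The digits of index -N <= j <= 0 are those at positions k = j + N <= N. *)
Definition padic_floor (R : realType) (p : nat) (Qp : fieldType)
    (absp : Qp -> R) (b : Qp) : Qp :=
  xget 0 [set y | exists N a, padic_expansion p absp b N a /\
    y = \sum_(k < N.+1) (a k)%:R * p%:R ^ (k%:Z - N%:Z)].

Definition lincomb (Qp : fieldType) (K : fieldExtType Qp) (e f : nat)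
    (gamma beta : K) (b : 'M[Qp]_(e, f)) : K :=
  \sum_(i < e) \sum_(j < f) b i j *: (gamma ^+ j * beta ^+ i).

(* xget picks the coordinates of alpha, which are unique. *)
Definition cf_floor (R : realType) (p : nat) (Qp : fieldType)
    (absp : Qp -> R) (K : fieldExtType Qp) (e f : nat) (gamma beta : K)
    (alpha : K) : K :=
  lincomb gamma beta (map_mx (padic_floor p absp)
    (xget 0 [set b : 'M[Qp]_(e, f) | alpha = lincomb gamma beta b])).

Definition cf_map (K : fieldType) (floorK : K -> K) (alpha : K) : K :=
  if alpha == 0 then 0 else alpha^-1 - floorK alpha^-1.

(* Meaningful only when iter n.-1 (cf_map floorK) alpha != 0. *)
Definition partial_quotient (K : fieldType) (floorK : K -> K) (n : nat)
    (alpha : K) : K :=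
  floorK (iter n.-1 (cf_map floorK) alpha)^-1.

Definition unit_ball (R : realType) (K : fieldType) (absK : K -> R) : set K :=
  [set x | absK x < 1].

(* K with the topology defined by absK. *)
Definition valued (R : realType) (K : fieldType) (absK : K -> R) : Type := K.

Section valued_topology.
Variables (R : realType) (K : fieldType) (absK : K -> R).

Definition valued_open (U : set (valued absK)) : Prop :=
  forall x : K, U x ->
    exists2 r : R, 0 < r & forall y : K, absK (y - x) < r -> U y.

HB.instance Definition _ := Choice.copy (valued absK) K.
HB.instance Definition _ := isPointed.Build (valued absK) (0 : K).

Lemma valued_openT : valued_open setT.
Proof. by move=> x _; exists 1. Qed.

Lemma valued_openI : setI_closed valued_open.
Proof.
move=> A B oA oB x [/oA[r r0 rA] /oB[s s0 sB]].
exists (Num.min r s); first by rewrite lt_min r0 s0.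
by move=> y; rewrite lt_min => /andP[yr ys]; split; [exact: rA|exact: sB].
Qed.

Lemma valued_open_bigU (I : Type) (f : I -> set (valued absK)) :
  (forall i, valued_open (f i)) -> valued_open (\bigcup_i f i).
Proof.
move=> of_ x [i _ /of_[r r0 rf]].
by exists r => // y /rf fy; exists i.
Qed.

HB.instance Definition _ := isOpenTopological.Build (valued absK)
  valued_openT valued_openI valued_open_bigU.

End valued_topology.

Notation borel absK := (g_sigma_algebraType (@open (valued absK))).

(* K is locally compact and second countable, so the regularity of a Haar
   measure follows from these conditions. *)
Definition is_haar (R : realType) (K : fieldType) (absK : K -> R)
    (mu : {measure set (borel absK) -> \bar R}) : Prop :=
  [/\ forall (x : K) (A : set (borel absK)), measurable A ->
        mu [set (x + y : K) | y in (A : set K)] = mu A,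
      forall C : set (valued absK), compact C -> (mu C < +oo)%E
    & mu setT != 0%E].

Definition measure_preserving (R : realType) (d : measure_display)
    (X : measurableType d) (nu : probability X R) (S : X -> X) : Prop :=
  measurable_fun setT S /\
  forall A : set X, measurable A -> nu (S @^-1` A) = nu A.

(* Sequences are indexed from 1; the value at 0 is irrelevant. *)
Definition increasing_pos_seq (a : nat -> nat) : Prop :=
  (forall n, (0 < n)%N -> (0 < a n)%N) /\
  (forall m n, (0 < m)%N -> (m < n)%N -> (a m < a n)%N).

Definition L2_good_universal (R : realType) (a : nat -> nat) : Prop :=
  increasing_pos_seq a /\
  forall (d : measure_display) (X : measurableType d) (nu : probability X R)
    (S : X -> X), measure_preserving nu S ->
  forall g : X -> R, g \in Lfun nu 2%:E ->
  \forall x \ae nu,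
    cvgn (fun n : nat => n%:R^-1 * \sum_(1 <= j < n.+1) g (iter (a j).-1 S x)).

Definition frac_part (R : realType) (x : R) : R := x - (Num.floor x)%:~R.

Definition uniformly_distributed_mod1 (R : realType) (x : nat -> R) : Prop :=
  forall I : interval R, [set` I] `<=` [set` `[0, 1[] ->
    (fun n : nat =>
       n%:R^-1 * (count (fun j => frac_part (x j) \in I) (iota 1 n))%:R)
      @ \oo --> fine (lebesgue_measure [set` I]).

(* Main.v *)
Require Import Defs.
From mathcomp Require Import all_boot all_order all_algebra all_field.
From mathcomp Require Import all_classical all_reals all_analysis.
From mathcomp Require Import measurable_realfun ring lra zify.
From Stdlib Require PeanoNat.

Import Order.TTheory GRing.Theory Num.Theory numFieldNormedType.Exports.

Set Implicit Arguments.
Unset Strict Implicit.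
Unset Printing Implicit Defensive.

Local Open Scope classical_set_scope.
Local Open Scope ring_scope.

(* The branches of the continued fraction map [T] on the unit ball [B] are
   [x |-> 1/x - c], one for each value [c] of the floor with [|c| > 1]. Its
   inverse [x |-> 1/(c + x)] multiplies all distances in [B] by [|c|^-2] and
   maps [B] onto a ball, hence multiplies Haar measure by a constant. As every
   branch is onto [B], the partial quotients are independent and identically
   distributed, and [|T^(j-1) x| <= rho^(k+1)] with [rho = p^(-1/e)] has
   probability [p^(-f k)]. Along any sequence of distinct indices the strong
   law of large numbers for uncorrelated variables then gives the limit
   [(1/e) * sum_k p^(-f k)]. *)

(** * Strong law of large numbers *)

(** Let the depth of [y != 0] in the unit ball be the [d] with [|y| = rho^d]. Since [|1/y| > 1] and
    [1/y] differs from its floor by less than 1, the floor also has absolute value [rho^-d], so each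
    partial quotient contributes [d/e]. The depth is the number of [k >= 0] with [|y| <= rho^(k+1)],
    which makes its mean a geometric series. The scaling factors of the branches are never added up
    directly: a branch scales all admissible sets by the same factor, so the total can be read off
    from the preimage of the whole unit ball. The dynamics use three properties of the floor: it
    moves points by less than 1, it is constant on cosets of the unit ball, and its values are
    countable. They rest on the fact that every element of [K] has coordinates with respect to the
    products [gamma^j beta^i], bounded by its absolute value. This is derived by counting classes of
    absolute values (at most [e]) and residue classes (at most [p^f]). *)

Lemma cvg_ratio_sqr (R : realType) :
  (fun k : nat => (k%:R / k.+1%:R) ^+ 2 : R) @ \oo --> (1 : R).
Proof.
have -> : (fun k : nat => (k%:R / k.+1%:R) ^+ 2 : R) =
          (fun k => (1 - harmonic k) * (1 - harmonic k)).
  apply/funext => k; rewrite expr2 /harmonic /=.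
  suff -> : k%:R / k.+1%:R = 1 - (k.+1%:R)^-1 :> R by [].
  have k1 : k.+1%:R != 0 :> R by rewrite pnatr_eq0.
  by apply: (mulIf k1); rewrite mulrBl mulfVK// mulVf// -natr1 mul1r addrK.
rewrite -[X in _ --> X](_ : (1 - 0) * (1 - 0) = 1 :> R); last by ring.
by apply: cvgM; apply: cvgB; (exact: cvg_cst || exact: cvg_harmonic).
Qed.

Lemma cvg_ratio_sqr_inv (R : realType) :
  (fun k : nat => (k.+1%:R / k%:R) ^+ 2 : R) @ \oo --> (1 : R).
Proof.
have -> : (fun k : nat => (k.+1%:R / k%:R) ^+ 2 : R) =
          (fun k => ((k%:R / k.+1%:R) ^+ 2)^-1).
  by apply/funext => k; rewrite -exprVn invfM invrK mulrC.
rewrite -[X in _ --> X]invr1; apply: cvgV; first exact: oner_neq0.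
exact: cvg_ratio_sqr.
Qed.

Lemma cvg_Nat_sqrt : PeanoNat.Nat.sqrt n @[n --> \oo] --> \oo.
Proof.
apply/cvgnyPge => A; exists (A * A)%N => // n /= An.
have [_ /ssrnat.ltP n_lt] := PeanoNat.Nat.sqrt_spec n (PeanoNat.Nat.le_0_l n).
rewrite multE in n_lt; set s := PeanoNat.Nat.sqrt n in n_lt *.
have := leq_ltn_trans An n_lt; nia.
Qed.

(* For nonnegative summands, [S_(k^2) <= S_n <= S_((k+1)^2)] as soon as
   [k^2 <= n <= (k+1)^2], and the ratio of the two indices tends to 1. *)
Lemma cesaro_squares (R : realType) (x : nat -> R) (M : R) :
  (forall j, 0 <= x j) ->
  (fun k : nat => (k * k)%:R^-1 * \sum_(j < k * k) x j) @ \oo --> M ->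
  (fun n : nat => n%:R^-1 * \sum_(j < n) x j) @ \oo --> M.
Proof.
move=> x0 xM; pose S n := \sum_(j < n) x j.
have S0 n : 0 <= S n by apply: sumr_ge0.
have Sle m n : (m <= n)%N -> S m <= S n.
  by move=> mn; rewrite /S -!(big_mkord xpredT x) (big_cat_nat _ mn)//= lerDl sumr_ge0.
pose A k := (k * k)%:R^-1 * S (k * k)%N : R.
pose L k := (k%:R / k.+1%:R) ^+ 2 * A k.
pose U k := (k.+1%:R / k%:R) ^+ 2 * A k.+1.
have LM : L k @[k --> \oo] --> M.
  by rewrite -[M]mul1r; apply: cvgM => //; exact: cvg_ratio_sqr.
have UM : U k @[k --> \oo] --> M.
  rewrite -[M]mul1r; apply: cvgM; first exact: cvg_ratio_sqr_inv.
  by rewrite (cvg_shiftS A).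
pose s := PeanoNat.Nat.sqrt.
apply: (@squeeze_cvgr _ _ _ _ (L \o s) (U \o s)); last 2 first.
- exact: (cvg_comp _ _ cvg_Nat_sqrt LM).
- exact: (cvg_comp _ _ cvg_Nat_sqrt UM).
near=> n; have n0 : (0 < n)%N by near: n; exists 1%N.
have [/ssrnat.leP sn /ssrnat.ltP ns] := PeanoNat.Nat.sqrt_spec n (PeanoNat.Nat.le_0_l n).
rewrite -/(s n) !multE in sn ns.
have k0 : (0 < s n)%N by case: (s n) ns => // ; lia.
rewrite /= /L /U /A; move: (s n) k0 sn ns => k k0 sn ns.
have kR : 0 < k%:R :> R by rewrite ltr0n.
have k1R : 0 < k.+1%:R :> R by rewrite ltr0n.
have nR : 0 < n%:R :> R by rewrite ltr0n.
have -> : (k%:R / k.+1%:R) ^+ 2 * ((k * k)%:R^-1 * S (k * k)%N) =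
          (k.+1 * k.+1)%:R^-1 * S (k * k)%N :> R.
  by rewrite !natrM; field; rewrite !gt_eqF.
have -> : (k.+1%:R / k%:R) ^+ 2 * ((k.+1 * k.+1)%:R^-1 * S (k.+1 * k.+1)%N) =
          (k * k)%:R^-1 * S (k.+1 * k.+1)%N :> R.
  by rewrite !natrM; field; rewrite !gt_eqF.
apply/andP; split; apply: ler_pM; rewrite ?S0 ?invr_ge0 ?ler0n//.
- by rewrite lef_pV2 ?posrE ?ltr0n// ?muln_gt0// ler_nat ltnW.
- exact: Sle.
- by rewrite lef_pV2 ?posrE ?ltr0n// ?muln_gt0 ?k0// ler_nat.
- by apply: Sle; rewrite ltnW.
Unshelve. all: by end_near. Qed.

Lemma sum_inv_sqr_le2 (R : realType) (n : nat) :
  \sum_(k < n) (k.+1%:R ^+ 2)^-1 <= 2 :> R.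
Proof.
(* The slack [2 / (m + 1)] makes the induction close: each step leaves
   [t / ((t + 1)^2 (t + 2)) >= 0]. *)
have key m : \sum_(k < m) (k.+1%:R ^+ 2)^-1 <= 2 - 2 / m.+1%:R :> R.
  elim: m => [|m IH]; first by rewrite big_ord0 divr1 subrr.
  rewrite big_ord_recr /=; apply: (le_trans (lerD IH (lexx _))).
  have m0 : 0 <= m%:R :> R by [].
  rewrite -subr_ge0 -[m.+2%:R]natr1 -[m.+1%:R]natr1; set t : R := m%:R in m0 *.
  have -> : 2 - 2 / (t + 1 + 1) - (2 - 2 / (t + 1) + ((t + 1) ^+ 2)^-1) =
            t / ((t + 1) ^+ 2 * (t + 2)).
    by field; apply/andP; split; apply: lt0r_neq0; lra.
  by apply: divr_ge0 => //; apply: mulr_ge0; [apply: exprn_ge0|]; lra.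
by apply: (le_trans (key n)); rewrite gerBl divr_ge0.
Qed.

(* Since [(S - m M)^2 + 2 m M S = S^2 + (m M)^2], only nonnegative functions
   have to be integrated. *)
Lemma integral_sqr_deviation_le (d : measure_display) (T : measurableType d)
    (R : realType) (mu : {measure set T -> \bar R}) (D : set T)
    (X : nat -> T -> R) (M C : R) :
  measurable D -> mu D = 1%E -> (forall n, measurable_fun D (X n)) ->
  (forall n x, D x -> 0 <= X n x) ->
  (forall n, (\int[mu]_(x in D) (X n x)%:E = M%:E)%E) ->
  (forall i j : nat, i != j ->
     (\int[mu]_(x in D) (X i x * X j x)%:E = (M * M)%:E)%E) ->
  (forall n, (\int[mu]_(x in D) (X n x * X n x)%:E <= C%:E)%E) ->
  forall m : nat,
  (\int[mu]_(x in D) ((\sum_(j < m) X j x - m%:R * M) ^+ 2)%:E <= (m%:R * C)%:E)%E.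
Proof.
move=> mD muD mX X0 EX EXX EX2 m; pose S x := \sum_(j < m) X j x.
have M0 : 0 <= M.
  by rewrite -lee_fin -(EX 0%N); apply: integral_ge0 => x Dx; rewrite lee_fin X0.
have C0 : 0 <= C.
  rewrite -lee_fin; apply: (le_trans _ (EX2 0%N)).
  by apply: integral_ge0 => x Dx; rewrite lee_fin mulr_ge0 ?X0.
have mS : measurable_fun D S by apply: measurable_sum.
have S0 x : D x -> 0 <= S x by move=> Dx; apply: sumr_ge0 => j _; exact: X0.
have ES : (\int[mu]_(x in D) (S x)%:E = (m%:R * M)%:E)%E.
  under eq_integral do rewrite -sumEFin.
  rewrite ge0_integral_sum//; last 2 first.
  - by move=> j; exact/measurable_EFinP.
  - by move=> j x Dx; rewrite lee_fin X0.
  under eq_bigr do rewrite EX.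
  by rewrite sumEFin sumr_const card_ord mulr_natl.
have ES2 : (\int[mu]_(x in D) (S x * S x)%:E <= (m%:R * C + (m%:R * M) ^+ 2)%:E)%E.
  have -> : (\int[mu]_(x in D) (S x * S x)%:E =
      \sum_(i : 'I_m * 'I_m) \int[mu]_(x in D) (X i.1 x * X i.2 x)%:E)%E.
    rewrite -ge0_integral_sum//; last 2 first.
    - by move=> i; apply/measurable_EFinP; exact: measurable_funM.
    - by move=> i x Dx; rewrite lee_fin mulr_ge0 ?X0.
    apply: eq_integral => x _; rewrite sumEFin; congr EFin.
    by rewrite /S mulr_suml -(pair_bigA _ (fun i j : 'I_m => X i x * X j x)) /=;
      apply: eq_bigr => i _; rewrite mulr_sumr.
  (* The diagonal bound is weakened from [C] to [M M + C], so that the terms [M M] add up to exactly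
     [(m M)^2]. *)
  apply: (@le_trans _ _ (\sum_(i : 'I_m * 'I_m)
      (M * M + if i.1 == i.2 then C else 0)%:E)%E).
    apply: lee_sum => -[i j] _ /=; case: eqVneq => [->|ij]; last first.
      by rewrite EXX// addr0.
    by rewrite (le_trans (EX2 _))// lee_fin lerDr mulr_ge0.
  rewrite sumEFin lee_fin big_split /= sumr_const card_prod card_ord.
  rewrite -(pair_bigA _ (fun i j : 'I_m => if i == j then C else 0)) /=.
  under [X in _ + X]eq_bigr => i _.
    rewrite (bigD1 i)//= eqxx big1 ?addr0; last first.
      by move=> j /negbTE; rewrite eq_sym => ->.
    over.
  rewrite sumr_const card_ord -[X in X + _]mulr_natl -[X in _ + X]mulr_natl natrM.
  by rewrite le_eqVlt; apply/orP; left; apply/eqP; ring.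
have mdev : measurable_fun D (fun x => (S x - m%:R * M) ^+ 2).
  by apply: measurable_funX; apply: measurable_funB.
have key : (\int[mu]_(x in D) ((S x - m%:R * M) ^+ 2)%:E +
    ((2 * (m%:R * M)) * (m%:R * M))%:E =
    \int[mu]_(x in D) (S x * S x)%:E + ((m%:R * M) ^+ 2)%:E)%E.
  have mM0 : 0 <= m%:R * M by rewrite mulr_ge0.
  rewrite [X in (_ + X)%E]EFinM -ES -ge0_integralZl_EFin//; last 2 first.
  - exact/measurable_EFinP.
  - by rewrite mulr_ge0.
  have -> : ((m%:R * M) ^+ 2)%:E = (\int[mu]_(x in D) ((m%:R * M) ^+ 2)%:E)%E.
    by rewrite integral_cst// muD mule1.
  rewrite -!ge0_integralD//.
  - by apply: eq_integral => x _; rewrite -EFinM -!EFinD; congr EFin; ring.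
  - by move=> x Dx; rewrite lee_fin mulr_ge0 ?S0.
  - by apply/measurable_EFinP; exact: measurable_funM.
  - by move=> x Dx; rewrite lee_fin exprn_ge0.
  - by move=> x Dx; rewrite lee_fin sqr_ge0.
  - exact/measurable_EFinP.
  - by move=> x Dx; rewrite lee_fin mulr_ge0 ?mulr_ge0 ?S0.
  - by apply/measurable_EFinP; exact: measurable_funM.
rewrite -(@leeD2rE _ ((2 * (m%:R * M)) * (m%:R * M))%:E)// key.
rewrite (le_trans (leeD2r _ ES2))// -!EFinD lee_fin.
by rewrite le_eqVlt; apply/orP; left; apply/eqP; ring.
Qed.

Lemma ae_fin_num_of_integral (d : measure_display) (T : measurableType d)
    (R : realType) (mu : {measure set T -> \bar R}) (D : set T)
    (f : T -> \bar R) :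
  measurable D -> measurable_fun D f -> (forall x, D x -> (0 <= f x)%E) ->
  (\int[mu]_(x in D) f x < +oo)%E ->
  {ae mu, forall x, D x -> f x \is a fin_num}.
Proof.
move=> mD mf f0 foo; apply: integrable_ae => //; apply/integrableP; split=> //.
by under eq_integral => x /[!inE] Dx do rewrite gee0_abs ?f0//.
Qed.

Lemma nneseries_fin_num_cvg0 (R : realType) (u : nat -> R) :
  (forall n, 0 <= u n) -> (\sum_(n <oo) (u n)%:E)%E \is a fin_num ->
  u n @[n --> \oo] --> 0.
Proof.
move=> u0 ufin; apply: cvg_series_cvg_0; apply: nondecreasing_is_cvgn.
  exact: nondecreasing_series.
exists (fine (\sum_(n <oo) (u n)%:E)%E) => _ [n _ <-].
rewrite -lee_fin fineK// /series /= -sumEFin; apply: nneseries_lim_ge => k _ _.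
by rewrite lee_fin.
Qed.

(** Along the squares [(k + 1)^2] the squared error of the average has expectation at most
    [C / (k + 1)^2]. This is summable, so the series of squared errors is almost everywhere finite
    and its terms tend to 0. Nonnegativity of the variables then fills the gaps between the
    squares. *)
Lemma slln_uncorrelated (d : measure_display) (T : measurableType d)
    (R : realType) (mu : {measure set T -> \bar R}) (D : set T)
    (X : nat -> T -> R) (M C : R) :
  measurable D -> mu D = 1%E -> (forall n, measurable_fun D (X n)) ->
  (forall n x, D x -> 0 <= X n x) ->
  (forall n, (\int[mu]_(x in D) (X n x)%:E = M%:E)%E) ->
  (forall i j : nat, i != j ->
     (\int[mu]_(x in D) (X i x * X j x)%:E = (M * M)%:E)%E) ->
  (forall n, (\int[mu]_(x in D) (X n x * X n x)%:E <= C%:E)%E) ->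
  {ae mu, forall x, D x ->
    (fun n : nat => n%:R^-1 * \sum_(j < n) X j x) @ \oo --> M}.
Proof.
move=> mD muD mX X0 EX EXX EX2.
pose Z (k : nat) x := ((k.+1 * k.+1)%:R^-1 *
  (\sum_(j < k.+1 * k.+1) X j x - (k.+1 * k.+1)%:R * M)) ^+ 2.
have mZ k : measurable_fun D (Z k).
  apply: measurable_funX; apply: measurable_funM => //.
  by apply: measurable_funB => //; exact: measurable_sum.
have Z0 k x : 0 <= Z k x by exact: sqr_ge0.
have C0 : 0 <= C.
  rewrite -lee_fin; apply: (le_trans _ (EX2 0%N)).
  by apply: integral_ge0 => x Dx; rewrite lee_fin mulr_ge0 ?X0.
have EZ k : (\int[mu]_(x in D) (Z k x)%:E <= (C * (k.+1%:R ^+ 2)^-1)%:E)%E.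
  under eq_integral do rewrite /Z exprMn EFinM.
  rewrite ge0_integralZl_EFin//; last 2 first.
  - by move=> x Dx; rewrite lee_fin sqr_ge0.
  - apply/measurable_EFinP; apply: measurable_funX; apply: measurable_funB => //.
    exact: measurable_sum.
  have dev := integral_sqr_deviation_le mD muD mX X0 EX EXX EX2 (k.+1 * k.+1)%N.
  apply: (le_trans (lee_wpmul2l _ dev)); first by rewrite lee_fin sqr_ge0.
  rewrite -EFinM lee_fin natrM le_eqVlt; apply/orP; left; apply/eqP.
  by field; rewrite addrC natr1 pnatr_eq0.
have : {ae mu, forall x, D x -> (\sum_(k <oo) (Z k x)%:E)%E \is a fin_num}.
  apply: ae_fin_num_of_integral => //.
  - apply: (@ge0_emeasurable_sum _ _ _ _ _ xpredT) => // [k x Dx _|k _].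
      by rewrite lee_fin.
    exact/measurable_EFinP.
  - by move=> x Dx; apply: nneseries_ge0 => k _ _; rewrite lee_fin.
  - rewrite integral_nneseries//; last 2 first.
    + by move=> k; exact/measurable_EFinP.
    + by move=> k x Dx; rewrite lee_fin.
    apply: (@le_lt_trans _ _ (C * 2)%:E); last by rewrite ltry.
    apply: lime_le.
      by apply: is_cvg_nneseries => k _ _; apply: integral_ge0 => x Dx; rewrite lee_fin.
    apply: nearW => n; rewrite big_mkord.
    apply: (@le_trans _ _ (\sum_(k < n) (C * (k.+1%:R ^+ 2)^-1)%:E)%E).
      by apply: lee_sum => k _; exact: EZ.
    by rewrite sumEFin lee_fin -mulr_sumr ler_wpM2l// sum_inv_sqr_le2.
apply: filterS => x Zx Dx; apply: (@cesaro_squares _ (X^~ x)).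
  by move=> j; exact: X0.
have /nneseries_fin_num_cvg0-/(_ (fun k => Z0 k x)) Zcvg := Zx Dx.
pose A k := (k * k)%:R^-1 * \sum_(j < k * k) X j x.
rewrite -/A -(cvg_shiftS A).
have devE k : (k.+1 * k.+1)%:R^-1 * (\sum_(j < k.+1 * k.+1) X j x
   - (k.+1 * k.+1)%:R * M) = A k.+1 - M.
  by rewrite mulrBr mulKf// pnatr_eq0.
apply/subr_cvg0; apply/norm_cvg0P.
have -> : (fun k => `|A k.+1 - M|) = (fun k => Num.sqrt (Z k x)).
  by apply/funext => k; rewrite /Z devE sqrtr_sqr.
rewrite -sqrtr0; apply: (cvg_comp _ _ Zcvg).
exact: sqrt_continuous.
Qed.

Lemma nneseries_geometric (R : realType) (s : R) : 0 <= s < 1 ->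
  (\sum_(k <oo) (s ^+ k)%:E = ((1 - s)^-1)%:E)%E.
Proof.
move=> /andP[s0 s1]; apply/cvg_lim => //.
rewrite (_ : (fun n => _) = EFin \o series (geometric 1 s)); last first.
  apply/funext => n; rewrite /series /= -sumEFin.
  by apply: eq_bigr => k _; rewrite /geometric /= mul1r.
rewrite -[X in _ --> X%:E]mul1r; apply: cvg_EFin; first exact: nearW.
by apply: cvg_geometric_series; rewrite ger0_norm.
Qed.

Lemma nneseries_geometric2 (R : realType) (s : R) : 0 <= s < 1 ->
  (\sum_(k <oo) \sum_(l <oo) (s ^+ k * s ^+ l)%:E =
   ((1 - s)^-1 * (1 - s)^-1)%:E)%E.
Proof.
move=> s01; have /andP[s0 s1] := s01.
transitivity (\sum_(k <oo) ((1 - s)^-1%:E * (s ^+ k)%:E))%E.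
  apply: eq_eseriesr => k _.
  transitivity (\sum_(l <oo) ((s ^+ k)%:E * (s ^+ l)%:E))%E.
    by apply: eq_eseriesr => l _; rewrite EFinM.
  rewrite nneseriesZl ?nneseries_geometric// 1?muleC// => l _.
  by rewrite lee_fin exprn_ge0.
rewrite nneseriesZl ?nneseries_geometric// ?EFinM// => l _.
by rewrite lee_fin exprn_ge0.
Qed.

Lemma nneseries_mul (R : realType) (a b : nat -> R) (A B : R) :
  (forall k, 0 <= a k) -> (forall l, 0 <= b l) ->
  (\sum_(k <oo) (a k)%:E = A%:E)%E -> (\sum_(l <oo) (b l)%:E = B%:E)%E ->
  (\sum_(k <oo) \sum_(l <oo) (a k * b l)%:E = (A * B)%:E)%E.
Proof.
move=> a0 b0 aA bB; transitivity (\sum_(k <oo) (B%:E * (a k)%:E))%E.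
  apply: eq_eseriesr => k _.
  transitivity (\sum_(l <oo) ((a k)%:E * (b l)%:E))%E.
    by apply: eq_eseriesr => l _; rewrite EFinM.
  by rewrite nneseriesZl ?bB 1?muleC// => l _; rewrite lee_fin.
by rewrite nneseriesZl ?aA 1?muleC// => l _; rewrite lee_fin.
Qed.

(* The variables [X j] count the sets of a decreasing sequence [G j] containing
   a point, so that their moments are double series of measures. *)
Lemma slln_counting (d : measure_display) (T : measurableType d)
    (R : realType) (mu : {measure set T -> \bar R}) (D : set T)
    (G : nat -> nat -> set T) (r : R) :
  measurable D -> mu D = 1%E -> 0 <= r < 1 ->
  (forall j k, measurable (G j k)) -> (forall j k, G j k `<=` D) ->
  (forall j k l, (k <= l)%N -> G j l `<=` G j k) ->
  (forall j k, mu (G j k) = (r ^+ k)%:E) ->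
  (forall i j k l, i != j -> mu (G i k `&` G j l) = (r ^+ k * r ^+ l)%:E) ->
  {ae mu, forall x, D x -> exists2 X : nat -> R,
    forall j, (\sum_(k <oo) (\1_(G j k) x)%:E = (X j)%:E)%E &
    (fun n : nat => n%:R^-1 * \sum_(j < n) X j) @ \oo --> (1 - r)^-1}.
Proof.
move=> mD muD r01 mG GD Gdec muG muGG; have /andP[r0 r1] := r01.
pose I j k x : R := \1_(G j k) x.
have I0 j k x : 0 <= I j k x by rewrite /I indicE.
pose Y j x := (\sum_(k <oo) (I j k x)%:E)%E.
have mI j k : measurable_fun D (I j k) by exact: measurable_indic.
have Y0 j x : (0 <= Y j x)%E by apply: nneseries_ge0 => k _ _; rewrite lee_fin.
have mY j : measurable_fun D (Y j).
  apply: (@ge0_emeasurable_sum _ _ _ _ _ xpredT) => // [k x _ _|k _].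
    by rewrite lee_fin.
  exact/measurable_EFinP.
have EY j : (\int[mu]_(x in D) Y j x = ((1 - r)^-1)%:E)%E.
  rewrite integral_nneseries//; last 2 first.
  - by move=> k; exact/measurable_EFinP.
  - by move=> k x _; rewrite lee_fin.
  rewrite -nneseries_geometric//; apply: eq_eseriesr => k _.
  by rewrite integral_indic// setIidl.
have Yfin : {ae mu, forall x, forall j, D x -> Y j x \is a fin_num}.
  apply: ae_foralln => j; apply: ae_fin_num_of_integral => //.
  by rewrite EY ltry.
(* The law of large numbers needs real-valued variables; [fine] alters [Y j] only on the null set
   where it is infinite. *)
pose X j x := fine (Y j x).
have X0 j x : 0 <= X j x by exact: fine_ge0.
have mX j : measurable_fun D (X j) by exact: measurableT_comp.
have EX j : (\int[mu]_(x in D) (X j x)%:E = ((1 - r)^-1)%:E)%E.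
  rewrite -(EY j); apply: ge0_ae_eq_integral => //.
  - exact/measurable_EFinP.
  - by move=> x _; rewrite lee_fin.
  - by move: Yfin; apply: filterS => x Yx Dx; rewrite /X fineK ?Yx.
pose W i j x := (\sum_(k <oo) \sum_(l <oo) (I i k x * I j l x)%:E)%E.
have mW i j k : measurable_fun D (fun x => \sum_(l <oo) (I i k x * I j l x)%:E)%E.
  apply: (@ge0_emeasurable_sum _ _ _ _ _ xpredT) => // [l x _ _|l _].
    by rewrite lee_fin mulr_ge0.
  by apply/measurable_EFinP; exact: measurable_funM.
have EXX i j : (\int[mu]_(x in D) (X i x * X j x)%:E =
    \sum_(k <oo) \sum_(l <oo) mu (G i k `&` G j l))%E.
  transitivity (\int[mu]_(x in D) W i j x)%E.
    apply: ge0_ae_eq_integral => //.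
    - by apply/measurable_EFinP; exact: measurable_funM.
    - apply: (@ge0_emeasurable_sum _ _ _ _ _ xpredT) => // k x _ _.
      by apply: nneseries_ge0 => l _ _; rewrite lee_fin mulr_ge0.
    - by move=> x _; rewrite lee_fin mulr_ge0.
    - move=> x _; apply: nneseries_ge0 => k _ _.
      by apply: nneseries_ge0 => l _ _; rewrite lee_fin mulr_ge0.
    - move: Yfin; apply: filterS => x Yx Dx; apply/esym/nneseries_mul => //.
      + by rewrite /X fineK ?Yx.
      + by rewrite /X fineK ?Yx.
  rewrite integral_nneseries//; last first.
    by move=> k x _; apply: nneseries_ge0 => l _ _; rewrite lee_fin mulr_ge0.
  apply: eq_eseriesr => k _; rewrite integral_nneseries//; last 2 first.
  - by move=> l; apply/measurable_EFinP; exact: measurable_funM.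
  - by move=> l x _; rewrite lee_fin mulr_ge0.
  apply: eq_eseriesr => l _; under eq_integral => x _.
    have -> : I i k x * I j l x = \1_(G i k `&` G j l) x :> R by rewrite indicI.
    over.
  rewrite integral_indic//; last exact: measurableI.
  by rewrite setIidl// => x [/GD].
(* For [k <= l] the sets are nested, so their intersection has measure [r^l = s^l s^l <= s^k s^l].
   The second moment is thus dominated by a product of two convergent geometric series. *)
pose s := Num.sqrt r; have ss : s * s = r by rewrite -expr2 sqr_sqrtr.
have s01 : 0 <= s < 1 by rewrite sqrtr_ge0 -sqrtr1 ltr_sqrt.
have EX2 j : (\int[mu]_(x in D) (X j x * X j x)%:E <=
    ((1 - s)^-1 * (1 - s)^-1)%:E)%E.
  rewrite EXX -nneseries_geometric2//.
  apply: lee_nneseries => [k _ _|k _]; first exact: nneseries_ge0.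
  apply: lee_nneseries => [l _ _//|l _].
  have /andP[s0 /ltW s1] := s01.
  wlog kl : k l / (k <= l)%N => [H|].
    have [/H//|/ltnW/H] := leqP k l; by rewrite setIC mulrC.
  rewrite setIidr; last exact: Gdec.
  rewrite muG lee_fin -ss exprMn ler_wpM2r ?exprn_ge0//.
  exact: ler_wiXn2l.
have EXXne i j : i != j ->
    (\int[mu]_(x in D) (X i x * X j x)%:E = ((1 - r)^-1 * (1 - r)^-1)%:E)%E.
  move=> ij; rewrite EXX -nneseries_geometric2//.
  by apply: eq_eseriesr => k _; apply: eq_eseriesr => l _; rewrite muGG.
have := slln_uncorrelated mD muD mX (fun j x _ => X0 j x) EX EXXne EX2.
move=> H; apply: filterS2 Yfin H => x Yx Xx Dx; exists (X^~ x); last exact: Xx.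
by move=> j; rewrite /X fineK ?Yx.
Qed.

(** * Absolute values *)

Lemma ler_exprz_lt1 (R : realFieldType) (x : R) (k l : int) : 0 < x < 1 ->
  (x ^ k <= x ^ l) = (l <= k).
Proof.
move=> /andP[x0 x1]; rewrite -(invrK x) !(exprz_inv x^-1) ler_eXz2l ?lerN2//.
by rewrite invf_gt1.
Qed.

Section AbsoluteValue.
Variables (R : realType) (F : fieldType) (abs : F -> R).
Hypothesis abs_absval : is_absval abs.

Lemma absval_ge0 x : 0 <= abs x. Proof. by case: abs_absval. Qed.

Lemma absval_eq0 x : (abs x == 0) = (x == 0).
Proof. by case: abs_absval => _ a0 _ _; apply/eqP/eqP => /a0. Qed.

Lemma absvalM x y : abs (x * y) = abs x * abs y.
Proof. by case: abs_absval. Qed.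

Lemma absval0 : abs 0 = 0. Proof. by apply/eqP; rewrite absval_eq0. Qed.

Lemma absval_gt0 x : (0 < abs x) = (x != 0).
Proof. by rewrite lt_def absval_ge0 andbT absval_eq0. Qed.

Lemma absval1 : abs 1 = 1.
Proof.
have a1 : abs 1 != 0 by rewrite absval_eq0 oner_neq0.
by apply: (mulfI a1); rewrite -absvalM !mulr1.
Qed.

Lemma absvalX x n : abs (x ^+ n) = abs x ^+ n.
Proof. by elim: n => [|n IH]; rewrite ?absval1// !exprS absvalM IH. Qed.

Lemma absvalN x : abs (- x) = abs x.
Proof.
have sq : abs (- 1) ^+ 2 = 1 by rewrite -absvalX sqrrN expr1n absval1.
have aN1 : abs (- 1) = 1.
  by apply/eqP; rewrite -(@eqrXn2 _ 2) ?absval_ge0// sq expr1n.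
by rewrite -mulN1r absvalM aN1 mul1r.
Qed.

Lemma absvalV x : abs x^-1 = (abs x)^-1.
Proof.
have [->|x0] := eqVneq x 0; first by rewrite invr0 absval0 invr0.
have ax : abs x != 0 by rewrite absval_eq0.
by apply: (mulfI ax); rewrite -absvalM !divff ?absval1.
Qed.

Lemma absvalXz x (n : int) : abs (x ^ n) = abs x ^ n.
Proof. by case: n => n; rewrite /exprz ?absvalV absvalX. Qed.

Lemma absval_distC x y : abs (x - y) = abs (y - x).
Proof. by rewrite -absvalN opprB. Qed.

Hypothesis abs_nat : forall n : nat, abs n%:R <= 1.

(* Expand [(x + y)^n] and let [n] tend to infinity in
   [|x + y|^n <= (n + 1) max(|x|, |y|)^n]. *)
Lemma absval_ultrametric x y : abs (x + y) <= Num.max (abs x) (abs y).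
Proof.
set M := Num.max _ _; rewrite leNgt; apply/negP => Mlt.
have M0 : 0 <= M by rewrite le_max absval_ge0.
have key n : abs (x + y) ^+ n <= n.+1%:R * M ^+ n.
  rewrite -absvalX exprDn.
  apply: (@le_trans _ _ (\sum_(i < n.+1) abs (x ^+ (n - i) * y ^+ i *+ 'C(n, i)))).
    elim/big_ind2 : _ => [|u u' v v' uv u'v'|//]; first by rewrite absval0.
    have [_ _ _ tri] := abs_absval.
    exact: le_trans (tri _ _) (lerD uv u'v').
  rewrite mulr_natl -[X in _ *+ X]card_ord -sumr_const.
  apply: ler_sum => i _; rewrite -mulr_natl !absvalM !absvalX.
  rewrite -[leRHS]mul1r ler_pM ?mulr_ge0 ?exprn_ge0 ?absval_ge0//.
  have /ltnSE/subnK ni := ltn_ord i; rewrite -[X in _ <= M ^+ X]ni exprD.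
  by rewrite ler_pM ?exprn_ge0 ?absval_ge0// lerXn2r ?nnegrE ?absval_ge0//
    le_max lexx ?orbT.
have a0 : 0 < abs (x + y) by apply: le_lt_trans Mlt.
pose q := M / abs (x + y).
have q0 : 0 <= q by rewrite divr_ge0// ltW.
have q1 : q < 1 by rewrite ltr_pdivrMr// mul1r.
have key2 n : 1 <= n.+1%:R * q ^+ n.
  by rewrite expr_div_n mulrA ler_pdivlMr ?exprn_gt0// mul1r.
have [q00|qn0] := eqVneq q 0.
  by have := key2 1%N; rewrite q00 expr1 mulr0 ler10.
have qgt0 : 0 < q by rewrite lt_def qn0.
(* Bernoulli: [(1 + h)^n >= C(n, 2) h^2] outgrows [n + 1] *)
pose h := q^-1 - 1.
have h0 : 0 < h by rewrite subr_gt0 invf_gt1.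
have key3 n : (1 + h) ^+ n <= n.+1%:R.
  by rewrite /h addrC subrK exprVn -[leLHS]mul1r ler_pdivrMr ?exprn_gt0.
clearbody h; have bern n : 'C(n, 2)%:R * h ^+ 2 <= (1 + h) ^+ n.
  have h0' := ltW h0; have [n2|n2] := ltnP n 2.
    by rewrite bin_small// mul0r; apply: exprn_ge0; apply: addr_ge0.
  rewrite exprDn (bigD1 (Ordinal (n2 : 2 < n.+1)%N)) //= expr1n mul1r mulr_natl.
  by rewrite lerDl; apply: sumr_ge0 => i _; rewrite expr1n mul1r mulrn_wge0// exprn_ge0.
(* With [T] the successor of the truncation, [T > h^-2], and [n = 4 T + 2] gives
   [C(n, 2) >= (n + 1) T], which contradicts [C(n, 2) h^2 <= n + 1]. *)
pose n := (4 * (Num.truncn (h ^+ 2)^-1).+1 + 2)%N.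
have := le_trans (bern n) (key3 n); apply/negP; rewrite -ltNge.
have hn : (h ^+ 2)^-1 < (Num.truncn (h ^+ 2)^-1).+1%:R by exact: truncnS_gt.
rewrite -ltr_pdivrMr ?exprn_gt0//.
apply: (@lt_le_trans _ _ (n.+1 * (Num.truncn (h ^+ 2)^-1).+1)%:R).
  by rewrite natrM ltr_pM2l.
rewrite ler_nat bin2 /n; move: (Num.truncn _) => t.
rewrite -divn2 leq_divRL//; nia.
Qed.

End AbsoluteValue.

Section Ultrametric.
Variables (R : realType) (F : fieldType) (abs : F -> R).
Hypothesis abs_absval : is_absval abs.
Hypothesis abs_ultra : forall x y, abs (x + y) <= Num.max (abs x) (abs y).

Lemma ultra_leD r x y : abs x <= r -> abs y <= r -> abs (x + y) <= r.
Proof. by move=> xr yr; rewrite (le_trans (abs_ultra _ _))// ge_max xr. Qed.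

Lemma ultra_ltD r x y : abs x < r -> abs y < r -> abs (x + y) < r.
Proof. by move=> xr yr; rewrite (le_lt_trans (abs_ultra _ _))// gt_max xr. Qed.

Lemma ultra_leB r x y : abs x <= r -> abs y <= r -> abs (x - y) <= r.
Proof. by move=> xr yr; rewrite ultra_leD// absvalN. Qed.

Lemma ultra_ltB r x y : abs x < r -> abs y < r -> abs (x - y) < r.
Proof. by move=> xr yr; rewrite ultra_ltD// absvalN. Qed.

Lemma ultra_le_dist_trans r y x z :
  abs (x - y) <= r -> abs (y - z) <= r -> abs (x - z) <= r.
Proof. by move=> xy yz; rewrite -(subrKA y) ultra_leD. Qed.

Lemma ultra_lt_dist_trans r y x z :
  abs (x - y) < r -> abs (y - z) < r -> abs (x - z) < r.
Proof. by move=> xy yz; rewrite -(subrKA y) ultra_ltD. Qed.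

(** If [x + y] were smaller than [x], then so would be [x = (x + y) - y]. *)
Lemma ultra_dominant x y : abs y < abs x -> abs (x + y) = abs x.
Proof.
move=> yx; apply/eqP; rewrite eq_le ultra_leD ?(ltW yx)//= leNgt; apply/negP => lt.
have := ultra_ltB lt yx; rewrite addrK ltxx//.
Qed.

Lemma ultra_le_sum (I : Type) (s : seq I) (P : pred I) (x : I -> F) r : 0 <= r ->
  (forall i, P i -> abs (x i) <= r) -> abs (\sum_(i <- s | P i) x i) <= r.
Proof.
move=> r0 xr; elim/big_ind : _ => //; first by rewrite absval0.
by move=> u v; exact: ultra_leD.
Qed.

Lemma ultra_lt_sum (I : Type) (s : seq I) (P : pred I) (x : I -> F) r : 0 < r ->
  (forall i, P i -> abs (x i) < r) -> abs (\sum_(i <- s | P i) x i) < r.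
Proof.
move=> r0 xr; elim/big_ind : _ => //; first by rewrite absval0.
by move=> u v; exact: ultra_ltD.
Qed.

(** A largest term, if nonzero, strictly exceeds all others and therefore determines the absolute
    value of the sum. *)
Lemma ultra_distinct_le_sum (I : finType) (x : I -> F) :
  (forall i j, x i != 0 -> x j != 0 -> abs (x i) = abs (x j) -> i = j) ->
  forall i, abs (x i) <= abs (\sum_i x i).
Proof.
move=> xinj i; case: (@Order.TotalTheory.arg_maxP _ _ _ i xpredT (abs \o x) isT) => m _ /= mmax.
have xi0 j : j != m -> abs (x j) < abs (x m) \/ x m = 0.
  move=> jm; have [xm0|xm0] := eqVneq (x m) 0; first by right.
  left; rewrite lt_neqAle mmax// andbT; apply: contraNneq jm => xjm.
  by apply/eqP/xinj => //; rewrite -(absval_eq0 abs_absval) xjm absval_eq0.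
have [xm0|xm0] := eqVneq (x m) 0.
  by rewrite (le_trans (mmax i isT))// xm0 absval0// absval_ge0.
rewrite (le_trans (mmax i isT))// (bigD1 m)//= ultra_dominant//.
apply: ultra_lt_sum => [|j jm]; first by rewrite absval_gt0.
by have [//|xm] := xi0 j jm; rewrite xm eqxx in xm0.
Qed.

End Ultrametric.

(** * Dynamics of the continued fraction map *)

Section Dynamics.
Variables (R : realType) (K : fieldType) (absK : K -> R).
Hypothesis absK_absval : is_absval absK.
Hypothesis ultra : forall x y, absK (x + y) <= Num.max (absK x) (absK y).
Variables (rho : R).
Hypothesis rho01 : 0 < rho < 1.
Hypothesis value_group : forall x, x != 0 -> exists k : int, absK x = rho ^ k.
Variable mu : {measure set (borel absK) -> \bar R}.
Hypothesis mu_translate : forall (x : K) (A : set (borel absK)), measurable A ->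
  mu [set (x + y : K) | y in (A : set K)] = mu A.
Let B := unit_ball absK.

Definition cball (x : K) (n : nat) : set K := [set y | absK (y - x) <= rho ^+ n].

Let absM := absvalM absK_absval.
Let absV := absvalV absK_absval.
Let absN := absvalN absK_absval.

Let rho_gt0 : 0 < rho. Proof. by case/andP: rho01. Qed.
Let rho_lt1 : rho < 1. Proof. by case/andP: rho01. Qed.

(** Nonzero absolute values are powers of [rho], so less than 1 means at most [rho]. Hence the shift
    in the measure of balls: radius [rho^(n+1)] goes with mass [r^n], and [n = 0] is the unit
    ball. *)
Lemma unit_ballE : B = cball 0 1.
Proof.
apply/seteqP; split => x; rewrite /B /unit_ball /cball /= subr0 expr1; last first.
  by move=> /le_lt_trans; apply.
have [->|x0] := eqVneq x 0; first by rewrite absval0// ltW.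
have [k ->] := value_group x0 => xlt1.
have : ~~ (rho ^ (0 : int) <= rho ^ k) by rewrite expr0z -ltNge.
rewrite ler_exprz_lt1// => k0; rewrite -(expr1z rho) ler_exprz_lt1//; lia.
Qed.

Lemma cball_subB x n : B x -> cball x n.+1 `<=` B.
Proof.
rewrite unit_ballE => Bx y yx; move: Bx yx; rewrite /cball /= !subr0 expr1.
move=> Bx yx; rewrite -(subrK x y) ultra_leD// (le_trans yx)// -[leRHS]expr1.
by rewrite ler_wiXn2l// ltW.
Qed.

Lemma measurable_cball x n : measurable (cball x n : set (borel absK)).
Proof.
apply: sub_sigma_algebra; change (valued_open (cball x n : set (valued absK))).
move=> y /= xy; exists (rho ^+ n); first exact: exprn_gt0.
by move=> z /ltW zy; rewrite /cball /=; exact: ultra_le_dist_trans zy xy.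
Qed.

Lemma mu_cball_translate x n : mu (cball x n) = mu (cball 0 n).
Proof.
rewrite -(mu_translate x (measurable_cball 0 n)); congr (mu _).
apply/seteqP; split => [y xy|_ [y xy <-]].
  by exists (y - x); rewrite /cball/= ?subr0// addrC subrK.
by move: xy; rewrite /cball /= subr0 addrC addKr.
Qed.

Variable r : R.
Hypothesis r01 : 0 <= r < 1.
Hypothesis mu_cball0 : forall n, mu (cball 0 n.+1) = (r ^+ n)%:E.

Lemma mu_cball x n : mu (cball x n.+1) = (r ^+ n)%:E.
Proof. by rewrite mu_cball_translate. Qed.

Lemma cball_bigcap x : \bigcap_n cball x n = [set x].
Proof.
apply/seteqP; split => [y xy|_ -> n _]; last first.
  by rewrite /cball /= subrr absval0// exprn_ge0// ltW.
apply/eqP; rewrite -subr_eq0 -(absval_eq0 absK_absval) eq_le absval_ge0// andbT.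
have rho_cvg : rho ^+ n @[n --> \oo] --> 0 by apply: cvg_expr; rewrite ger0_norm// ltW.
rewrite -(cvg_lim _ rho_cvg)//; apply: limr_ge; first by apply/cvg_ex; exists 0.
by apply: nearW => n; apply: xy.
Qed.

Lemma measurable_point (x : K) : measurable ([set x] : set (borel absK)).
Proof.
by rewrite -cball_bigcap; apply: bigcapT_measurable => n; exact: measurable_cball.
Qed.

(** The point lies in balls of mass [r^n], which tends to 0. This disposes of the origin, which no
    branch reaches. *)
Lemma mu_point (x : K) : mu ([set x] : set (borel absK)) = 0%E.
Proof.
apply/eqP; rewrite eq_le measure_ge0 andbT.
have [r0 r1] := andP r01.
have r_cvg : (r ^+ n)%:E @[n --> \oo] --> 0%E.
  by apply: cvg_EFin; [exact: nearW|apply: cvg_expr; rewrite ger0_norm].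
rewrite -(cvg_lim _ r_cvg)//; apply: lime_ge; first by apply/cvg_ex; exists 0%E.
apply: nearW => n; rewrite -(mu_cball x); apply: le_measure.
- by rewrite inE; exact: measurable_point.
- by rewrite inE; exact: measurable_cball.
- by move=> _ ->; rewrite /cball /= subrr absval0// exprn_ge0// ltW.
Qed.

(* By the second condition the image of the unit ball is a full ball. *)
Definition similarity (s : K -> K) (j : nat) : Prop :=
  (forall x y, B x -> B y -> absK (s x - s y) = rho ^+ j * absK (x - y)) /\
  (forall x z, B x -> absK (z - s x) <= rho ^+ j.+1 -> exists2 y, B y & s y = z).

Lemma similarity_id : similarity id 0.
Proof.
split=> [x y _ _|x z Bx zx]; first by rewrite mul1r.
by exists z => //; exact: (@cball_subB x 0).
Qed.

Lemma similarity_comp s t i j : similarity s i -> similarity t j ->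
  (forall x, B x -> B (t x)) -> similarity (s \o t) (i + j).
Proof.
move=> [si1 si2] [tj1 tj2] tB; split=> [x y Bx By|x z Bx zx] /=.
  by rewrite si1 ?tj1// ?exprD ?mulrA//; exact: tB.
have [||y By yz] := si2 (t x) z; first exact: tB.
  by apply: (le_trans zx); rewrite ler_wiXn2l ?ltW// ltnS leq_addr.
have [|w Bw wy] := tj2 x y Bx; last by exists w; rewrite //= wy.
have rj : 0 < rho ^+ i by exact: exprn_gt0.
rewrite -(ler_pM2l rj) -si1 ?yz//; last exact: tB.
by apply: (le_trans zx); rewrite -exprD addnS.
Qed.

Lemma similarity_inj s j : similarity s j -> {in B &, injective s}.
Proof.
move=> [s1 _] x y /set_mem Bx /set_mem By /eqP.
rewrite -subr_eq0 -(absval_eq0 absK_absval) s1//.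
by rewrite mulf_eq0 expf_eq0 gt_eqF//= andbF orFb absval_eq0// subr_eq0 => /eqP.
Qed.

Lemma similarity_cball s j x n : similarity s j -> B x ->
  s @` cball x n.+1 = cball (s x) (j + n).+1.
Proof.
move=> [s1 s2] Bx; have rj : 0 < rho ^+ j by exact: exprn_gt0.
apply/seteqP; split => [_ [y xy <-]|z xz].
  rewrite /cball /= s1//; last exact: cball_subB xy.
  by rewrite -addnS exprD ler_wpM2l// ltW.
have [|y By yz] := s2 x z Bx.
  by apply: (le_trans xz); rewrite ler_wiXn2l ?ltW// ltnS leq_addr.
exists y => //; rewrite /cball /= -(ler_pM2l rj) -s1// yz.
by move: xz; rewrite /cball /= -addnS exprD.
Qed.

Lemma absval_add_small c x : 1 < absK c -> B x -> absK (c + x) = absK c.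
Proof. by move=> c1 Bx; apply: ultra_dominant => //; exact: lt_trans Bx c1. Qed.

Lemma unit_ball_branch c x : 1 < absK c -> B x -> B (c + x)^-1.
Proof.
by move=> c1 Bx; rewrite /B /unit_ball /= absV absval_add_small// invf_lt1//
  (lt_trans _ c1).
Qed.

Lemma similarity_branch c : 1 < absK c ->
  exists j, similarity (fun x => (c + x)^-1) j.
Proof.
move=> c1; have c0 : c != 0.
  by apply: contraTneq c1 => ->; rewrite absval0// ltNge ler01.
have a0 : 0 < absK c by rewrite absval_gt0.
have [[k ck|k ck]] := value_group c0.
  by move: c1; rewrite ck ltNge exprn_ile1// ltW.
have cE : (absK c)^-1 = rho ^+ k.+1 by rewrite ck NegzE -exprnN invrK.
have cx0 x : B x -> c + x != 0.
  by move=> Bx; rewrite -(absval_gt0 absK_absval) absval_add_small.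
have jE : rho ^+ (k.+1 + k.+1) = (absK c)^-1 * (absK c)^-1 by rewrite exprD -cE.
exists (k.+1 + k.+1)%N; split=> [x y Bx By|x z Bx].
  rewrite jE.
  have -> : (c + x)^-1 - (c + y)^-1 = (y - x) * ((c + x)^-1 * (c + y)^-1).
    by field; rewrite !cx0.
  rewrite !absM !absV (absval_add_small c1 Bx) (absval_add_small c1 By) mulrC.
  by rewrite (absval_distC absK_absval).
rewrite (exprS rho (k.+1 + k.+1)) jE => zx.
(* The error [rho |c|^-2] is less than [|c|^-1], so [z] has the absolute value of [(c + x)^-1] and
   is invertible. *)
have zE : absK z = (absK c)^-1.
  rewrite -(subrK (c + x)^-1 z) addrC ultra_dominant// absV absval_add_small//.
  apply: (le_lt_trans zx); rewrite mulrA gtr_pMl ?invr_gt0//.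
  by apply: mulr_ilt1; rewrite ?invr_ge0 ?ltW// invf_lt1.
have z0 : z != 0 by rewrite -(absval_gt0 absK_absval) zE invr_gt0.
exists (z^-1 - c); last by rewrite addrC subrK invrK.
(* Inversion magnifies the distance by [|c|^2], so the candidate preimage [z^-1 - c] is within [rho]
   of [x] and stays in the ball. *)
have Bd : absK (z^-1 - (c + x)) <= rho.
  have -> : z^-1 - (c + x) = - (z - (c + x)^-1) * (z^-1 * (c + x)).
    by field; rewrite z0 cx0.
  rewrite !absM absN absV zE invrK (absval_add_small c1 Bx).
  by rewrite -ler_pdivlMr ?mulr_gt0// invfM.
have -> : z^-1 - c = (z^-1 - (c + x)) + x by rewrite opprD addrA subrK.
by apply: ultra_ltD => //; exact: le_lt_trans Bd _.
Qed.

(* Measurable sets whose measure is scaled as expected by every similarity. The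
   class contains the balls and is closed under countable disjoint unions and
   under preimages by the continued fraction map, which is all that is needed. *)
Definition scales (A : set K) : Prop :=
  A `<=` B /\ forall s j, similarity s j ->
    measurable (s @` A : set (borel absK)) /\
    (mu (s @` A) = (r ^+ j)%:E * mu A)%E.

Lemma scales_measurable A : scales A -> measurable (A : set (borel absK)).
Proof. by case=> _ /(_ _ _ similarity_id)[]; rewrite image_id. Qed.

Lemma scales_cball x n : B x -> scales (cball x n.+1).
Proof.
move=> Bx; split=> [|s j sj]; first exact: cball_subB.
rewrite (similarity_cball n sj Bx); split; first exact: measurable_cball.
by rewrite !mu_cball exprD EFinM.
Qed.

Lemma scales_unit_ball : scales B.
Proof.
rewrite unit_ballE; apply: scales_cball.
by rewrite /B /unit_ball /= absval0.
Qed.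

Lemma scales_point x : B x -> scales [set x].
Proof.
move=> Bx; split=> [_ ->//|s j _]; rewrite image_set1; split.
  exact: measurable_point.
by rewrite !mu_point mule0.
Qed.

Lemma scales_set0 : scales set0.
Proof.
by split=> [//|s j _]; rewrite image_set0 measure0 mule0; split.
Qed.

Lemma scales_bigcup (A : nat -> set K) : (forall n, scales (A n)) ->
  trivIset setT A -> scales (\bigcup_n A n).
Proof.
move=> sA tA; have AB n : A n `<=` B by case: (sA n).
split=> [|s j sj]; first exact: bigcup_sub.
have msA n : measurable (s @` A n : set (borel absK)).
  by have [_ /(_ _ _ sj)[]] := sA n.
have musA n : (mu (s @` A n) = (r ^+ j)%:E * mu (A n))%E.
  by have [_ /(_ _ _ sj)[]] := sA n.
rewrite image_bigcup; split; first exact: bigcupT_measurable.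
have tsA : trivIset setT (fun n => s @` A n).
  move=> m n _ _ [_ [[x Amx <-] [y Any sxy]]]; apply: tA => //.
  exists x; split=> //; rewrite (similarity_inj sj _ _ (esym sxy))// inE.
    exact: AB Amx.
  exact: AB Any.
have mA n : measurable (A n : set (borel absK)) by exact: scales_measurable.
rewrite (measure_semi_bigcup mu msA tsA) ?(measure_semi_bigcup mu mA tA)//;
  try exact: bigcupT_measurable.
rewrite -nneseriesZl//.
by apply: eq_eseriesr => n _; exact: musA.
Qed.

(** * Branches of the continued fraction map *)

Variable fl : K -> K.
Hypothesis fl_dist : forall x, absK (x - fl x) < 1.
Hypothesis fl_eq : forall x y, absK (x - y) < 1 -> fl x = fl y.
Variable idx : K -> nat.
Hypothesis idx_inj : forall x y, idx (fl x) = idx (fl y) -> fl x = fl y.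

Let T := cf_map fl.

Lemma cf_map_unit_ball x : B (T x).
Proof.
rewrite /T /cf_map; case: eqP => _; last exact: fl_dist.
by rewrite /B /unit_ball /= absval0.
Qed.

Lemma fl_add_small c x : fl c = c -> B x -> fl (c + x) = c.
Proof. by move=> {2}<- Bx; apply: fl_eq; rewrite addrC addKr. Qed.

(** The code [n] turns the branches into a sequence, since [idx] separates the floor values. The
    bound on the inverse selects the branches with image in [cball 0 k.+1]. *)
Definition digit k n c :=
  [/\ fl c = c, 1 < absK c, (absK c)^-1 <= rho ^+ k.+1 & idx c = n].

Lemma digit_inj k n c c' : digit k n c -> digit k n c' -> c = c'.
Proof.
move=> [cf _ _ cn] [cf' _ _ cn']; rewrite -cf -cf'; apply: idx_inj.
by rewrite cf cf' cn cn'.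
Qed.

Definition branch k n (A : set K) : set K :=
  [set y | exists c x, [/\ digit k n c, A x & y = (c + x)^-1]].

(** The weight is chosen before the set [A], which later allows the total weight to be determined
    from a single set. It is 0 if [n] codes no admissible floor value, and [r^j] if the branch is a
    similarity with exponent [j]. *)
Lemma branch_scales k n : exists2 w : R, 0 <= w & forall A, scales A ->
  scales (branch k n A) /\ (mu (branch k n A) = w%:E * mu A)%E.
Proof.
have [[c cd]|noc] := pselect (exists c, digit k n c); last first.
  exists 0 => // A _; have -> : branch k n A = set0.
    by apply/seteqP; split => // y [c [x [cd _ _]]]; apply: noc; exists c.
  by rewrite measure0 mul0e; split=> //; exact: scales_set0.
have [_ c1 _ _] := cd; have [j cj] := similarity_branch c1.
exists (r ^+ j) => [|A sA]; first by rewrite exprn_ge0//; case/andP: r01.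
have [AB _] := sA.
have -> : branch k n A = (fun x => (c + x)^-1) @` A.
  apply/seteqP; split => [y [c' [x [c'd Ax ->]]]|_ [x Ax <-]].
    by rewrite (digit_inj c'd cd); exists x.
  by exists c, x.
have [_ /(_ _ _ cj)[_ ->]] := sA; split => //; split.
  by move=> _ [x /AB Bx <-]; exact: unit_ball_branch.
move=> s i si; rewrite image_comp.
have sicj := similarity_comp si cj (fun x Bx => unit_ball_branch c1 Bx).
have [_ /(_ _ _ sicj)[mA muA]] := sA.
have [_ /(_ _ _ cj)[_ ->]] := sA.
by split=> //; rewrite muA exprD EFinM muleA.
Qed.

(** Cell 0 takes care of the origin, a fixed point by convention that lies in no branch image; the
    branches are shifted by one. *)
Definition cell k (A : set K) (n : nat) : set K :=
  if n is n'.+1 then branch k n' A else [set x | x = 0 /\ A 0].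

(** A point [(c + x)^-1] of a branch is nonzero, and the floor of its inverse returns [c], hence its
    code. *)
Lemma trivIset_cell k A : A `<=` B -> trivIset setT (cell k A).
Proof.
move=> AB.
have b0 n x : branch k n A x -> x <> 0.
  move=> [c [y [[_ c1 _ _] /AB By ->]]] /eqP; rewrite invr_eq0 -(absval_eq0 absK_absval).
  by rewrite absval_add_small// gt_eqF// (lt_trans _ c1).
move=> [|m] [|n] _ _ [x [/= xm xn]] //.
- by have [x0 _] := xm; case: (b0 _ _ xn).
- by have [x0 _] := xn; case: (b0 _ _ xm).
have [c [y [[cf _ _ <-] /AB By xE]]] := xm.
have [d [z [[df _ _ <-] /AB Bz]]] := xn; rewrite xE => /invr_inj cydz.
by rewrite -(fl_add_small cf By) cydz (fl_add_small df Bz).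
Qed.

(** Whether [(c + y)^-1] lies in [cball 0 k.+1] depends on [c] alone, because [|c + y| = |c|].
    Conversely, a nonzero [x] of that ball belongs to the branch of [fl x^-1], which has the
    absolute value of [x^-1]. *)
Lemma bigcup_cell k A : A `<=` B ->
  \bigcup_n cell k A n = cball 0 k.+1 `&` T @^-1` A.
Proof.
move=> AB; apply/seteqP; split => [x [[|n] _ /=]|x [xk ATx]].
- move=> [-> A0]; rewrite /cball /T /cf_map /= eqxx subrr absval0//.
  by rewrite exprn_ge0// ltW.
- move=> [c [y [[cf c1 ck _] Ay ->]]].
  have cy := absval_add_small c1 (AB _ Ay).
  rewrite /cball /= subr0 absV cy; split => //.
  rewrite /T /cf_map invr_eq0 -(absval_eq0 absK_absval) cy gt_eqF ?(lt_trans _ c1)//.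
  by rewrite invrK (fl_add_small cf (AB _ Ay)) addrC addKr.
have [x0|x0] := eqVneq x 0.
  by exists 0%N => //=; split=> //; move: ATx; rewrite x0 /T /cf_map /= eqxx.
pose c := fl x^-1; have x1 : 1 < absK x^-1.
  rewrite absV invf_gt1 ?absval_gt0//.
  have : B x by apply: (@cball_subB 0 k) xk; rewrite /B /unit_ball /= absval0.
  by [].
have cE : absK c = absK x^-1.
  rewrite -(subrK x^-1 c) addrC ultra_dominant// (absval_distC absK_absval).
  exact: lt_trans (fl_dist _) x1.
exists (idx c).+1 => //; exists c, (T x); split => //.
- split=> //; last 2 first.
  + by rewrite cE.
  + by rewrite cE absV invrK; move: xk; rewrite /cball /= subr0.
  by rewrite /c; apply: fl_eq; rewrite (absval_distC absK_absval).
- by rewrite /T /cf_map (negbTE x0) addrC subrK invrK.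
Qed.

(** The measure of the preimage is [mu A] times a total weight depending on [k] only. For [A = B]
    the preimage is all of [cball 0 k.+1], so this weight is [r^k]. The case [k = 0] is the
    invariance of the measure; the general case makes the depth of a point independent of its
    image. *)
Lemma preimage_scales k A : scales A ->
  scales (cball 0 k.+1 `&` T @^-1` A) /\
  (mu (cball 0 k.+1 `&` T @^-1` A) = (r ^+ k)%:E * mu A)%E.
Proof.
move=> sA; have [AB _] := sA.
have B0 : B 0 by rewrite /B /unit_ball /= absval0.
have [w w0 wP] : exists2 w : nat -> R, (forall n, 0 <= w n) &
    forall A n, scales A -> scales (cell k A n) /\ (mu (cell k A n) = (w n)%:E * mu A)%E.
  have := branch_scales k; move=> /(_ _)/cid2-/all_sig2[w w0 wP].
  exists (fun n => if n is n'.+1 then w n' else 0); first by case.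
  move=> A' [|n] sA'; last exact: wP.
  suff sc : scales (cell k A' 0) /\ mu (cell k A' 0) = 0%E by rewrite mul0e.
  have [A0|A0] := pselect (A' 0).
    have -> : cell k A' 0 = [set 0] by apply/seteqP; split => x /=; [case|].
    by split; [exact: scales_point|exact: mu_point].
  have -> : cell k A' 0 = set0 by apply/seteqP; split => x //= [].
  by split; [exact: scales_set0|exact: measure0].
have scell A' : scales A' -> scales (cball 0 k.+1 `&` T @^-1` A') /\
  (mu (cball 0 k.+1 `&` T @^-1` A') = \sum_(n <oo) (w n)%:E * mu A')%E.
  move=> sA'; have [A'B _] := sA'.
  rewrite -bigcup_cell//; split.
    by apply: scales_bigcup; [move=> n; case: (wP A' n sA')|exact: trivIset_cell].
  have mc n : measurable (cell k A' n : set (borel absK)).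
    by apply: scales_measurable; case: (wP A' n sA').
  rewrite (measure_semi_bigcup mu mc (trivIset_cell (k:=k) A'B)); last first.
    exact: bigcupT_measurable.
  by apply: eq_eseriesr => n _; case: (wP A' n sA').
have [sTA muTA] := scell _ sA; split=> //; rewrite muTA.
have muB : mu B = 1%E by rewrite unit_ballE mu_cball.
have [_] := scell _ scales_unit_ball.
rewrite setIidl; last by move=> x _; exact: cf_map_unit_ball.
rewrite mu_cball => ->.
(* Finiteness allows [mu A] to be taken out of the series of weights. *)
have Afin : mu A \is a fin_num.
  rewrite ge0_fin_numE//; apply: (@le_lt_trans _ _ 1%E); last by rewrite ltry.
  rewrite -muB; apply: le_measure => //.
  - by rewrite inE; exact: scales_measurable.
  - by rewrite inE; apply: scales_measurable; exact: scales_unit_ball.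
rewrite muB muleC -(fineK Afin) -nneseriesZl; last first.
  by move=> n _; rewrite mule1 lee_fin.
by apply: eq_eseriesr => n _; rewrite mule1 muleC.
Qed.

Definition iter_preimage j (A : set K) : set K := B `&` iter j T @^-1` A.

Lemma iter_preimageS j A :
  iter_preimage j.+1 A = B `&` T @^-1` iter_preimage j A.
Proof.
apply/seteqP; split => x /=; rewrite /iter_preimage /= -iterS iterSr.
  by move=> [Bx ATx]; split=> //; split=> //; exact: cf_map_unit_ball.
by move=> [Bx [_ ATx]].
Qed.

Lemma iter_preimageD i j A :
  iter_preimage (i + j) A = iter_preimage i (iter_preimage j A).
Proof.
elim: i => [|i IH]; last by rewrite addSn !iter_preimageS IH.
by rewrite add0n /iter_preimage /= setIA setIid.
Qed.

Lemma iter_preimage_scales j A : scales A ->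
  scales (iter_preimage j A) /\ mu (iter_preimage j A) = mu A.
Proof.
move=> sA; elim: j => [|j [IH1 IH2]].
  by have [AB _] := sA; rewrite /iter_preimage /= setIidr.
have := preimage_scales 0 IH1; rewrite -unit_ballE -iter_preimageS expr0 mul1e.
by rewrite IH2.
Qed.

(** The intersection is the [i]-fold preimage of those points of [cball 0 k.+1] that the map sends
    into the [(j - i - 1)]-fold preimage of the other ball. Invariance removes the outer and the
    inner preimage, and [preimage_scales] splits off [r^k] in between. *)
Lemma mu_iter_preimageI i j k l : (i < j)%N ->
  mu (iter_preimage i (cball 0 k.+1) `&` iter_preimage j (cball 0 l.+1)) =
  (r ^+ k * r ^+ l)%:E.
Proof.
move=> ij; have B0 : B 0 by rewrite /B /unit_ball /= absval0.
have <- : (i + (j - i.+1).+1 = j)%N by rewrite addnS -addSn subnKC.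
rewrite iter_preimageD iter_preimageS.
have sl := scales_cball l B0.
have [sj muj] := iter_preimage_scales (j - i.+1) sl.
have [sk muk] := preimage_scales k sj.
have [_ mui] := iter_preimage_scales i sk.
rewrite EFinM -(mu_cball 0 l) -muj -muk -mui; congr (mu _).
apply/seteqP; split => x /=; rewrite /iter_preimage /=.
  by move=> [[Bx xk] [_ [_ H]]].
move=> [Bx [xk H]]; split=> //; split=> //; split=> //.
exact: (cball_subB B0 xk).
Qed.

Lemma ae_average_depth (b : nat -> nat) : injective b ->
  {ae mu, forall x, B x -> exists2 d : nat -> nat,
    forall j, absK (iter (b j) T x) = rho ^+ d j &
    (fun n : nat => n%:R^-1 * \sum_(j < n) (d j)%:R) @ \oo --> (1 - r)^-1}.
Proof.
move=> binj; have B0 : B 0 by rewrite /B /unit_ball /= absval0.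
pose G j k := iter_preimage (b j) (cball 0 k.+1).
have sG j k : scales (G j k) /\ mu (G j k) = mu (cball 0 k.+1).
  by apply: iter_preimage_scales; exact: scales_cball.
have muB : mu B = 1%E by rewrite unit_ballE mu_cball.
have mB : measurable (B : set (borel absK)) by apply: scales_measurable scales_unit_ball.
have mG j k : measurable (G j k : set (borel absK)).
  by apply: scales_measurable; case: (sG j k).
have GB j k : G j k `<=` B by move=> x [].
have Gdec j k l : (k <= l)%N -> G j l `<=` G j k.
  move=> kl x [Bx xl]; split=> //; move: xl; rewrite /cball /=.
  by move=> /le_trans; apply; rewrite ler_wiXn2l ?ltW.
have muG j k : mu (G j k) = (r ^+ k)%:E by rewrite -(mu_cball 0); case: (sG j k).
have muGG i j k l : i != j -> mu (G i k `&` G j l) = (r ^+ k * r ^+ l)%:E.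
  move=> ij; have [bij|bji] := ltnP (b i) (b j); first exact: mu_iter_preimageI.
  rewrite setIC mulrC; apply: mu_iter_preimageI.
  by rewrite ltn_neqAle bji andbT; apply: contraNneq ij => /binj ->.
apply: filterS (slln_counting mB muB r01 mG GB Gdec muG muGG).
move=> x H Bx; have {H}[X XG Xcvg] := H Bx.
have TB j : B (iter (b j) T x).
  by case: (b j) => [//|n]; rewrite iterS; exact: cf_map_unit_ball.
have depth j : exists2 d : nat, absK (iter (b j) T x) = rho ^+ d & X j = d%:R.
  have GE k : G j k x <-> absK (iter (b j) T x) <= rho ^+ k.+1.
    by rewrite /G /iter_preimage /cball /= subr0; split=> [[]|].
  (* A vanishing iterate would lie in every ball and make the count infinite, whereas [X j] is a
     real number. *)
  have y0 : iter (b j) T x != 0.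
    apply/eqP => y0; have XE : (\sum_(k <oo) cst 1 k = (X j)%:E)%E.
      rewrite -XG; apply: eq_eseriesr => k _; rewrite indicE mem_set//; apply/GE.
      by rewrite y0 absval0// exprn_ge0// ltW.
    pose n := (Num.truncn (X j)).+1.
    have := @nneseries_lim_ge R (cst 1%E) xpredT 0 n (fun _ _ _ => @lee01 R).
    rewrite XE big_mkord sumEFin lee_fin sumr_const card_ord leNgt => /negP; apply.
    exact: truncnS_gt.
  have [[d dE|d dE]] := value_group y0; last first.
    have := TB j; rewrite /B /unit_ball /= dE NegzE -exprnN invf_lt1 ?exprn_gt0//.
    by rewrite ltNge exprn_ile1// ltW.
  exists d => //; apply/EFin_inj; rewrite -XG.
  (* A point of depth [d] lies in exactly the sets with index [k < d], so the count equals [d]. *)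
  have GI k : \1_(G j k) x = (k < d)%:R :> R.
    rewrite indicE; congr (nat_of_bool _)%:R; apply/idP/idP.
      by move=> /set_mem/GE; rewrite dE exprnP ler_exprz_lt1.
    by move=> kd; apply/mem_set/GE; rewrite dE ler_wiXn2l// ltW.
  rewrite (nneseries_split 0 d); last by move=> k _; rewrite lee_fin indicE.
  rewrite [X in (_ + X)%E]eseries0 ?adde0; last first.
    by move=> k dk _; rewrite GI ltnNge dk.
  rewrite big_mkord (eq_bigr (fun=> 1%E)) => [|k _]; last by rewrite GI ltn_ord.
  by rewrite sumEFin sumr_const card_ord.
have [d dE dX] := all_sig2 (fun j => cid2 (depth j)).
by exists d => //; rewrite (_ : (fun n => _) = (fun n : nat => n%:R^-1 * \sum_(j < n) X j))//;
  apply/funext => n; congr (_ * _); apply: eq_bigr => j _; rewrite dX.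
Qed.

End Dynamics.

(** * The p-adic field *)

Section PadicField.
Variables (R : realType) (p : nat) (Qp : fieldType) (absp : Qp -> R).
Hypothesis p_prime : prime p.
Hypothesis Qp_completion : is_padic_completion p absp.

Lemma padic_absval : is_absval absp. Proof. by case: Qp_completion. Qed.
Let absp_av := padic_absval.
Let abspM := absvalM absp_av.
Let abspV := absvalV absp_av.

Let p_gt0 : 0 < p%:R :> R. Proof. by rewrite ltr0n prime_gt0. Qed.
Let p_gt1 : 1 < p%:R :> R. Proof. by rewrite ltr1n prime_gt1. Qed.

Lemma padic_abs_int (z : int) : z != 0 ->
  absp z%:~R = p%:R ^- logn p `|z|%N.
Proof.
move=> z0; case: Qp_completion => _ absq _ _.
rewrite -ratr_int absq /padic_abs_rat intr_eq0 (negbTE z0) numq_int.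
by rewrite denq_int logn1 sub0r -exprnN.
Qed.

Lemma padic_abs_nat_le1 (n : nat) : absp n%:R <= 1.
Proof.
have [->|n0] := eqVneq n 0%N; first by rewrite absval0.
rewrite pmulrn padic_abs_int ?eqz_nat// invf_le1 ?exprn_gt0//.
by rewrite exprn_ege1// ltW.
Qed.

Lemma padic_abs_ultrametric x y : absp (x + y) <= Num.max (absp x) (absp y).
Proof. exact: absval_ultrametric absp_av padic_abs_nat_le1 x y. Qed.
Let absp_ultra := padic_abs_ultrametric.

Lemma padic_abs_int_le1 (z : int) : absp z%:~R <= 1.
Proof.
case: z => n; first exact: padic_abs_nat_le1.
by rewrite NegzE mulrNz absvalN//; exact: padic_abs_nat_le1.
Qed.

Lemma padic_abs_p : absp p%:R = p%:R^-1.
Proof.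
rewrite pmulrn padic_abs_int ?eqz_nat -?lt0n ?prime_gt0//=.
by rewrite logn_prime// eqxx expr1.
Qed.

Lemma padic_abs_int_lt1 (z : int) : (absp z%:~R < 1) = (p %| `|z|)%N.
Proof.
have [->|z0] := eqVneq z 0; first by rewrite absval0// ltr01 dvdn0.
rewrite padic_abs_int// invf_lt1 ?exprn_gt0// exprn_egt1//.
have az : (0 < `|z|)%N by rewrite absz_gt0.
by rewrite -lt0n logn_gt0 mem_primes p_prime az.
Qed.

Lemma padic_abs_nat_lt1 (n : nat) : (absp n%:R < 1) = (p %| n)%N.
Proof. by rewrite pmulrn padic_abs_int_lt1. Qed.

Lemma padic_value_group x : x != 0 -> exists k : int, absp x = p%:R ^ k.
Proof.
move=> x0; have ax : 0 < absp x by rewrite absval_gt0.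
case: Qp_completion => _ absq dense _; have [q xq] := dense x _ ax.
have qE : absp (ratr q) = absp x.
  by rewrite -(subrK x (ratr q)) addrC ultra_dominant// (absval_distC absp_av).
have := absq q; rewrite qE /padic_abs_rat; case: eqP => [_ x00|_ ->].
  by rewrite x00 ltxx in ax.
by eexists.
Qed.

Lemma padic_abs_lt1 x : (absp x < 1) = (absp x <= p%:R^-1).
Proof.
apply/idP/idP; last by move=> /le_lt_trans; apply; rewrite invf_lt1.
have [->|x0] := eqVneq x 0; first by rewrite absval0// invr_ge0 ltW.
have [k ->] := padic_value_group x0 => k1.
have : p%:R ^ k < p%:R ^ (0 : int) :> R by rewrite expr0z.
by rewrite ltr_eXz2l// -exprN1 ler_eXz2l//; lia.
Qed.

Lemma padic_digit x : absp x <= 1 -> exists2 a : nat, (a < p)%N & absp (x - a%:R) < 1.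
Proof.
move=> x1; case: Qp_completion => _ absq dense _; have [q xq] := dense x _ (@ltr01 R).
have q1 : absp (ratr q) <= 1.
  by rewrite -(subrK x (ratr q)) ultra_leD// ltW// (absval_distC absp_av).
set n := numq q; set d := denq q.
(* As [q] is in lowest terms, a denominator divisible by [p] would force [|q| > 1]. *)
have pd : ~~ (p %| `|d|)%N.
  apply/negP => pd; have pn : ~~ (p %| `|n|)%N.
    apply/negP => pn; have : (p %| gcdn `|n| `|d|)%N by rewrite dvdn_gcd pn.
    by rewrite (eqP (coprime_num_den q)) dvdn1 => /eqP p1; move: p_prime; rewrite p1.
  have n0 : n != 0 by apply: contraNneq pn => ->; rewrite dvdn0.
  move: q1; rewrite /ratr -/n -/d abspM abspV ler_pdivrMr; last first.
    by rewrite padic_abs_int ?denq_neq0// invr_gt0 exprn_gt0.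
  rewrite mul1r leNgt => /negP; apply.
  apply: (@lt_le_trans _ _ 1); first by rewrite padic_abs_int_lt1.
  by rewrite leNgt padic_abs_int_lt1.
have cop : coprimez d p by rewrite coprimezE coprime_sym prime_coprime.
have /coprimezP[[u v] /= uv] := cop.
(* By Bezout [u] inverts [d] modulo [p], so [a] is the residue of [n / d]. *)
pose a := (n * u %% p)%Z.
have pz0 : (p%:Z : int) != 0 by rewrite eqz_nat -lt0n prime_gt0.
have a0 : 0 <= a by exact: modz_ge0.
have ap : a < p%:Z by rewrite ltz_pmod// ltz_nat prime_gt0.
have aE : n - a * d = p%:Z * (n * v + (n * u %/ p)%Z * d).
  have nE := divz_eq (n * u) p; rewrite -/a in nE.
  have -> : a = n * u - (n * u %/ p)%Z * p by apply/eqP; rewrite eq_sym subr_eq addrC; apply/eqP.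
  by rewrite -[X in X - _ = _]mulr1 -uv; ring.
clearbody a; have d1 : absp d%:~R = 1.
  by apply/eqP; rewrite eq_le padic_abs_int_le1 leNgt padic_abs_int_lt1.
have d0 : d%:~R != 0 :> Qp by rewrite -(absval_eq0 absp_av) d1 oner_eq0.
exists `|a|%N; first by rewrite -ltz_nat gez0_abs.
have aabs : (`|a|%N)%:R = a%:~R :> Qp by rewrite pmulrn gez0_abs.
rewrite aabs; apply: (ultra_lt_dist_trans absp_ultra xq).
have -> : ratr q - a%:~R = (n - a * d)%:~R / d%:~R :> Qp.
  by rewrite intrB intrM mulrBl mulfK.
rewrite abspM abspV d1 invr1 mulr1 aE padic_abs_int_lt1 abszM.
exact: dvdn_mulr.
Qed.

(** Multiplication by [p^N] makes [b] integral; then the digit is subtracted and the rest divided by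
    [p], repeatedly. After [n] digits the remainder is an integral [z n] times [p^(n - N)]. *)
Lemma padic_expansion_exists b : exists N a, padic_expansion p absp b N a.
Proof.
have [N bN] : exists N : nat, absp b <= p%:R ^+ N.
  have [->|b0] := eqVneq b 0; first by exists 0%N; rewrite absval0.
  have [[k|k] ->] := padic_value_group b0; first by exists k.
  by exists 0%N; rewrite NegzE -exprnN invf_le1 ?exprn_gt0// exprn_ege1// ltW.
have /choice[dig digP] : forall x : Qp, exists a : nat, absp x <= 1 ->
    (a < p)%N /\ absp (x - a%:R) < 1.
  move=> x; have [x1|x1] := boolP (absp x <= 1); last by exists 0%N.
  by have [a ap xa] := padic_digit x1; exists a.
have pQ : p%:R != 0 :> Qp.
  by rewrite -(absval_eq0 absp_av) padic_abs_p invr_eq0 gt_eqF.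
pose step x := (x - (dig x)%:R) / p%:R.
pose z n := iter n step (b * p%:R ^+ N).
have z1 n : absp (z n) <= 1.
  elim: n => [|n IH]; rewrite /z /=.
    by rewrite abspM absvalX// padic_abs_p exprVn ler_pdivrMr ?exprn_gt0 ?mul1r.
  rewrite -/(z n) abspM abspV padic_abs_p invrK.
  have [_] := digP _ IH; rewrite padic_abs_lt1 => h.
  by rewrite -ler_pdivlMr// div1r.
exists N, (fun k => dig (z k)); split=> [k|]; first by case: (digP _ (z1 k)).
have key n : b - \sum_(k < n) (dig (z k))%:R * p%:R ^ (k%:Z - N%:Z) =
    z n * p%:R ^ (n%:Z - N%:Z).
  elim: n => [|n IH].
    by rewrite big_ord0 subr0 /z /= sub0r -exprnN mulfK// expf_neq0.
  rewrite big_ord_recr /= opprD addrA IH -mulrBl /z /= -/(z n) /step.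
  have -> : n.+1%:Z - N%:Z = n%:Z - N%:Z + 1 by lia.
  rewrite [_ ^ (_ + 1)]expfzDr// expr1z.
  by field.
have -> : (fun n => absp (b - \sum_(k < n) (dig (z k))%:R * p%:R ^ (k%:Z - N%:Z))) =
   (fun n => absp (z n) * (p%:R ^+ N * p%:R^-1 ^+ n)).
  apply/funext => n; rewrite key abspM absvalXz// padic_abs_p exprz_inv opprB.
  by rewrite expfzDr ?gt_eqF// -exprnP -exprnN exprVn.
apply: (@squeeze_cvgr _ _ _ _ (cst 0) (fun n => p%:R ^+ N * p%:R^-1 ^+ n)).
- apply: nearW => n; have c0 : 0 <= p%:R ^+ N * p%:R^-1 ^+ n :> R.
    by rewrite mulr_ge0// exprn_ge0// invr_ge0.
  by apply/andP; split; [apply: mulr_ge0 => //; exact: absval_ge0|exact: ler_piMl].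
- exact: cvg_cst.
- rewrite -[X in _ --> X](mulr0 (p%:R ^+ N)); apply: cvgMr.
  by apply: cvg_expr; rewrite ger0_norm ?invr_ge0 ?ltW// invf_lt1.
Qed.

(** These are the elements of [Z[1/p]] in the real interval [[0, p)], which represent [Qp] modulo
    [p Zp]. *)
Definition digit_rational (y : Qp) : Prop :=
  exists N i : nat, (i < p ^ N.+1)%N /\ y = i%:R / p%:R ^+ N.

Lemma padic_floor_spec b :
  absp (b - padic_floor p absp b) < 1 /\ digit_rational (padic_floor p absp b).
Proof.
have pQ : p%:R != 0 :> Qp.
  by rewrite -(absval_eq0 absp_av) padic_abs_p invr_eq0 gt_eqF.
rewrite /padic_floor; set S := (X in xget 0 X).
have /(xgetPex 0) : exists y, S y.
  have [N [a aE]] := padic_expansion_exists b.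
  by eexists; exists N, a; split; first exact: aE.
move: (xget 0 S) => y [N [a [[ap bE] yE]]]; split; last first.
  exists N, (\sum_(k < N.+1) a k * p ^ k)%N; split.
    have : forall n, (\sum_(k < n) a k * p ^ k < p ^ n)%N.
      elim=> [|n IH]; first by rewrite big_ord0.
      rewrite big_ord_recr /= expnS; have := ap n.
      set s := (\sum_(k < n) _)%N in IH *; set q := (p ^ n)%N in IH *.
      by move=> an; nia.
    exact.
  rewrite yE natr_sum mulr_suml; apply: eq_bigr => k _.
  by rewrite natrM natrX expfzDr// -exprnP -exprnN mulrA.
(* A longer partial sum adds to the floor only terms with positive exponent, so it suffices to have
   one that is close to [b]. *)
have [n nN bn] : exists2 n, (N < n)%N &
    absp (b - \sum_(k < n) (a k)%:R * p%:R ^ (k%:Z - N%:Z)) < 1.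
  have /cvgr0Pnorm_lt/(_ _ (@ltr01 R))[M _ MP] := bE.
  exists (maxn N.+1 M); first exact: leq_maxl.
  by have := MP (maxn N.+1 M) (leq_maxr _ _); rewrite /= ger0_norm ?absval_ge0.
apply: (ultra_lt_dist_trans absp_ultra bn).
rewrite yE -!(big_mkord xpredT (fun k => (a k)%:R * p%:R ^ (k%:Z - N%:Z))).
rewrite (big_cat_nat _ nN)//= addrAC subrr add0r big_nat.
apply: (ultra_lt_sum absp_av absp_ultra) => // k /andP[Nk _].
rewrite abspM absvalXz// padic_abs_p exprz_inv opprB.
apply: (@le_lt_trans _ _ (p%:R ^ (N%:Z - k%:Z))).
  by rewrite ler_piMl ?padic_abs_nat_le1// exprz_ge0// ltW.
by rewrite -(expr0z p%:R) ltr_eXz2l//; lia.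
Qed.

(** Over a common denominator [p^M] both numerators lie below [p^(M+1)], while closeness forces
    [p^(M+1)] to divide their difference. In particular the floor does not depend on the expansion
    that [xget] picks. *)
Lemma digit_rational_inj y y' : digit_rational y -> digit_rational y' ->
  absp (y - y') < 1 -> y = y'.
Proof.
have pQ : p%:R != 0 :> Qp.
  by rewrite -(absval_eq0 absp_av) padic_abs_p invr_eq0 gt_eqF.
move=> [N [i [iN ->]]] [N' [i' [iN' ->]]].
pose M := (N + N')%N; pose u := (i * p ^ N')%N; pose u' := (i' * p ^ N)%N.
have uM : (u < p ^ M.+1)%N by rewrite /u /M -addSn expnD ltn_pmul2r ?expn_gt0 ?prime_gt0.
have u'M : (u' < p ^ M.+1)%N.
  by rewrite /u' /M addnC -addSn expnD ltn_pmul2r ?expn_gt0 ?prime_gt0.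
have -> : i%:R / p%:R ^+ N = u%:R / p%:R ^+ M :> Qp.
  by rewrite /u /M natrM natrX exprD; field; rewrite !expf_neq0.
have -> : i'%:R / p%:R ^+ N' = u'%:R / p%:R ^+ M :> Qp.
  by rewrite /u' /M natrM natrX exprD; field; rewrite !expf_neq0.
rewrite -mulrBl abspM abspV absvalX// padic_abs_p exprVn invrK.
have [<-//|uu'] := eqVneq u u'.
have uz : u%:Z - u'%:Z != 0 by rewrite subr_eq0 eqz_nat.
have -> : u%:R - u'%:R = (u%:Z - u'%:Z)%:~R :> Qp by rewrite rmorphB.
rewrite padic_abs_int// mulrC ltr_pdivrMr ?exprn_gt0// mul1r ltr_eXn2l//.
rewrite -pfactor_dvdn ?absz_gt0//; last first.
move=> /dvdn_leq; rewrite absz_gt0 => /(_ uz); lia.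
Qed.

Lemma padic_floor_eq b b' : absp (b - b') < 1 ->
  padic_floor p absp b = padic_floor p absp b'.
Proof.
move=> bb'; have [bf fd] := padic_floor_spec b; have [b'f f'd] := padic_floor_spec b'.
apply: digit_rational_inj => //.
apply: (ultra_lt_dist_trans absp_ultra) (ultra_lt_dist_trans absp_ultra bb' b'f).
by rewrite (absval_distC absp_av).
Qed.

End PadicField.

(** * Finite extensions *)

Section LocalField.
Variables (R : realType) (p : nat) (Qp : fieldType) (absp : Qp -> R).
Hypothesis p_prime : prime p.
Hypothesis Qp_completion : is_padic_completion p absp.
Variables (K : fieldExtType Qp) (absK : K -> R).
Hypothesis absK_absval : is_absval absK.
Hypothesis absK_ext : forall a : Qp, absK a%:A = absp a.

Let absp_av := padic_absval Qp_completion.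
Let absp_ultra := padic_abs_ultrametric p_prime Qp_completion.
Let absM := absvalM absK_absval.
Let absV := absvalV absK_absval.
Let absX := absvalX absK_absval.
Let absC := absval_distC absK_absval.

Let p_gt0 : 0 < p%:R :> R. Proof. by rewrite ltr0n prime_gt0. Qed.
Let p_gt1 : 1 < p%:R :> R. Proof. by rewrite ltr1n prime_gt1. Qed.

Lemma absvalZ a x : absK (a *: x) = absp a * absK x.
Proof. by rewrite -mulr_algl absM absK_ext. Qed.

Lemma absval_nat n : absK n%:R = absp n%:R.
Proof. by rewrite -absK_ext scaler_nat. Qed.

Lemma ext_ultrametric x y : absK (x + y) <= Num.max (absK x) (absK y).
Proof.
apply: absval_ultrametric => // n; rewrite absval_nat.
exact: padic_abs_nat_le1 p_prime Qp_completion n.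
Qed.
Let ultra := ext_ultrametric.

(** * The value group of [K] *)

Section RamificationIndex.
Variable e : nat.
Hypothesis ramK : ramification_index absK {: K} e.

Lemma ramification_index_gt0 : (0 < e)%N.
Proof.
have /card_set_bijP[phi [phi_fun _ _]] := ramK.
have S1 : [set [set absK (x * a%:A) | a in [set a : Qp | a != 0]]
     | x in [set x : K | (x \in fullv) && (x != 0)]]
     [set absK (1 * a%:A) | a in [set a : Qp | a != 0]].
  by exists 1 => //=; rewrite memvf oner_neq0.
by have /= := phi_fun _ S1; case: e.
Qed.

Variable (rho : R) (beta : K).
Hypothesis rho01 : 0 < rho < 1.
Hypothesis rho_e : rho ^+ e = p%:R^-1.
Hypothesis abs_beta : absK beta = rho^-1.

Let rho_gt0 : 0 < rho. Proof. by case/andP: rho01. Qed.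
Let rho_lt1 : rho < 1. Proof. by case/andP: rho01. Qed.

Lemma exprz_rho_inj : injective (exprz rho).
Proof. by apply: ieexprIz => //; rewrite lt_eqF. Qed.

Lemma padic_abs_rho a : a != 0 -> exists k : int, absp a = rho ^ (e%:Z * k).
Proof.
move=> /(padic_value_group p_prime Qp_completion)[k ->]; exists (- k).
by rewrite -exprz_exp -exprnP rho_e exprz_inv opprK.
Qed.

Lemma absval_beta_exp i : absK (beta ^+ i) = rho ^ (- i%:Z).
Proof. by rewrite absX abs_beta exprVn exprnN. Qed.

(** Modulo the values of [Qp], which are powers of [rho^e], the absolute values of [beta^i] for
    [i < e] are distinct because the exponents [-i] differ modulo [e]. There are only [e] classes,
    so [x] shares its class with some [beta^i]. *)
Lemma ext_value_group x : x != 0 -> exists k : int, absK x = rho ^ k.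
Proof.
move=> x0; pose c (y : K) := [set absK (y * a%:A) | a in [set a : Qp | a != 0]].
have /card_set_bijP[phi [phi_fun phi_inj _]] := ramK.
have beta0 : beta != 0 by rewrite -(absval_eq0 absK_absval) abs_beta invr_eq0 gt_eqF.
have cS y : y != 0 -> [set c z | z in [set z : K | (z \in fullv) && (z != 0)]] (c y).
  by move=> y0; exists y => //=; rewrite memvf.
have c_lt y : y != 0 -> (phi (c y) < e)%N by move=> /cS/phi_fun.
have cself y : c y (absK y) by exists 1 => /=; rewrite ?oner_neq0// scale1r mulr1.
have c_beta i j : (i < j)%N -> (j < e)%N -> c (beta ^+ i) <> c (beta ^+ j).
  move=> ij je cij; have := cself (beta ^+ i); rewrite cij => -[a /= a0].
  have [k ak] := padic_abs_rho a0; rewrite absM absK_ext !absval_beta_exp ak.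
  rewrite -expfzDr ?gt_eqF// => /exprz_rho_inj E.
  by have [k0|k0] := lerP k 0; nia.
pose h (i : 'I_e) := Ordinal (c_lt (beta ^+ i) (expf_neq0 i beta0)).
have h_inj : injective h.
  move=> i j /(congr1 val) /= hij.
  have cij : c (beta ^+ i) = c (beta ^+ j).
    by apply: phi_inj => //; rewrite inE; apply: cS; rewrite expf_neq0.
  apply/val_inj => /=; case: (ltngtP i j) => // [ij|ji].
    by case: (c_beta i j ij (ltn_ord j) cij).
  by case: (c_beta j i ji (ltn_ord i) (esym cij)).
have /codomP[i xi] := injF_onto h_inj (Ordinal (c_lt x x0)).
have cxi : c x = c (beta ^+ i).
  apply: phi_inj; rewrite ?inE; [exact: cS|by apply: cS; rewrite expf_neq0|].
  by have /(congr1 val) := xi.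
have := cself x; rewrite cxi => -[a /= a0 <-].
have [k ak] := padic_abs_rho a0; rewrite absM absK_ext absval_beta_exp ak.
by rewrite -expfzDr ?gt_eqF//; eexists.
Qed.

End RamificationIndex.

(** * The residue field and its roots of unity *)

Section ResidueField.
Variable (f : nat) (gamma : K).
Hypothesis resK : residue_degree absp absK {: K} f.
Hypothesis gamma_prim : (p ^ f).-1.-primitive_root gamma.

Definition digit_comb (m : nat) (u : 'I_m -> K) (d : {ffun 'I_m -> 'I_p}) : K :=
  \sum_(i < m) (d i)%:R *: u i.

Lemma digit_comb_exists m (u : 'I_m -> K) (a : 'I_m -> Qp) :
  (forall i, absK (u i) <= 1) -> (forall i, absp (a i) <= 1) ->
  exists2 d : {ffun 'I_m -> 'I_p}, forall i, absp (a i - (d i)%:R) < 1 &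
    absK (\sum_(i < m) a i *: u i - digit_comb u d) < 1.
Proof.
move=> u1 a1.
have /choice[d dP] : forall i : 'I_m, exists d : 'I_p, absp (a i - d%:R) < 1.
  move=> i; have [d dp da] := padic_digit p_prime Qp_completion (a1 i).
  by exists (Ordinal dp).
exists (finfun d) => [i|]; first by rewrite ffunE.
rewrite /digit_comb -sumrB.
apply: (ultra_lt_sum absK_absval ultra) => // i _.
rewrite -scalerBl absvalZ ffunE.
by apply: (le_lt_trans _ (dP i)); rewrite ler_piMr// absval_ge0.
Qed.

Lemma digit_dist_lt1 (i j : 'I_p) : absp (i%:R - j%:R) < 1 -> i = j.
Proof.
rewrite !pmulrn -intrB (padic_abs_int_lt1 p_prime Qp_completion) => pij.
apply/val_inj/eqP => /=; apply/negPn/negP => ij.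
have := dvdn_leq _ pij; rewrite absz_gt0 subr_eq0 eqz_nat ij => /(_ isT).
by have := ltn_ord i; have := ltn_ord j; lia.
Qed.

(** Rounding coefficients over a residue basis to digits codes the residue classes by [p^f] values;
    this is the upper bound behind the pigeonhole arguments below. *)
Lemma residue_index : exists h : K -> {ffun 'I_f -> 'I_p},
  forall x y, absK x <= 1 -> absK y <= 1 -> h x = h y <-> absK (x - y) < 1.
Proof.
have [u [u1 u_span u_free]] := resK.
have /choice[h hP] : forall x : K, exists d : {ffun 'I_f -> 'I_p},
    absK x <= 1 -> absK (x - digit_comb u d) < 1.
  move=> x; have [x1|x1] := boolP (absK x <= 1); last first.
    by exists [ffun=> Ordinal (prime_gt0 p_prime)].
  have [a [a1 xa]] := u_span x (memvf x) x1.
  have [d _ ad] := digit_comb_exists (fun i => (u1 i).2) a1.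
  by exists d => _; exact: ultra_lt_dist_trans xa ad.
exists h => x y /hP xh /hP yh; split=> [hxy|xy].
  by apply: (ultra_lt_dist_trans ultra xh); rewrite hxy absC.
apply/ffunP => i; apply: digit_dist_lt1; move: i.
apply: u_free => [i|].
  by apply: (ultra_leB absp_av absp_ultra);
    exact: padic_abs_nat_le1 p_prime Qp_completion _.
rewrite (_ : \sum_(i < f) _ = digit_comb u (h x) - digit_comb u (h y)); last first.
  by rewrite /digit_comb -sumrB; apply: eq_bigr => i _; rewrite scalerBl.
apply: (ultra_lt_dist_trans ultra (y := x)); first by rewrite absC.
exact: (ultra_lt_dist_trans ultra xy yh).
Qed.

Let n := (p ^ f).-1.
Let n_gt0 : (0 < n)%N. Proof. exact: prim_order_gt0 gamma_prim. Qed.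

Lemma absval_gamma : absK gamma = 1.
Proof.
have /eqP := absX gamma n; rewrite (prim_expr_order gamma_prim) absval1// eq_sym.
by rewrite pexpr_eq1 ?absval_ge0// => /eqP.
Qed.

Lemma absval_gammaX i : absK (gamma ^+ i) = 1.
Proof. by rewrite absX absval_gamma expr1n. Qed.

Lemma natr_n_unit : absK n%:R = 1.
Proof.
rewrite absval_nat; apply/eqP; rewrite eq_le (padic_abs_nat_le1 p_prime Qp_completion).
rewrite leNgt (padic_abs_nat_lt1 p_prime Qp_completion) /n.
move: n_gt0; rewrite /n; case: f => [|f'] //= _; apply/negP => pn.
have pq : (p %| p ^ f'.+1)%N by rewrite expnS dvdn_mulr.
have := dvdn_sub pq pn; rewrite -subn1 subKn ?expn_gt0 ?prime_gt0// dvdn1.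
by move=> /eqP p1; move: p_prime; rewrite p1.
Qed.

(** For [z = gamma^(j - i)] other than 1 the sum of [z^k] over [k < n] vanishes. If [z] were
    congruent to 1, this sum would be congruent to [n], which is a unit because [p] does not divide
    [p^f - 1]. *)
Lemma gammaX_dist i j : (i < n)%N -> (j < n)%N ->
  absK (gamma ^+ i - gamma ^+ j) < 1 -> i = j.
Proof.
wlog ij : i j / (i <= j)%N => [H|ilt jlt].
  have [/H//|/ltnW ji ilt jlt] := leqP i j; rewrite absC => ?.
  by apply/esym/H.
rewrite absC -(subnKC ij) exprD -[X in _ - X]mulr1 -mulrBr absM absval_gammaX mul1r.
set z := gamma ^+ (j - i) => z1.
have [z_eq1|z_neq1] := eqVneq z 1.
  have : gamma ^+ i == gamma ^+ j.
    by rewrite -[X in _ == _ ^+ X](subnKC ij) exprD -/z z_eq1 mulr1.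
  by rewrite (eq_prim_root_expr gamma_prim) -/n !modn_small// subnKC// => /eqP.
have sum0 : \sum_(k < n) z ^+ k = 0.
  apply/eqP; have /eqP := subrX1 z n.
  rewrite /z exprAC (prim_expr_order gamma_prim) expr1n subrr eq_sym mulf_eq0.
  by rewrite subr_eq0 -/z (negbTE z_neq1).
have : absK (\sum_(k < n) (z ^+ k - 1)) < 1.
  apply: (ultra_lt_sum absK_absval ultra) => // k _.
  rewrite subrX1 absM (le_lt_trans _ z1)// ler_piMr ?absval_ge0//.
  apply: (ultra_le_sum absK_absval ultra) => // l _.
  by rewrite /z -exprM absval_gammaX.
rewrite sumrB sum0 sumr_const card_ord sub0r absvalN// natr_n_unit ltxx//.
Qed.

Definition root_or_zero (o : option 'I_n) : K :=
  if o is Some i then gamma ^+ i else 0.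

Lemma root_or_zero_le1 o : absK (root_or_zero o) <= 1.
Proof. by case: o => [i|] /=; rewrite ?absval_gammaX ?absval0. Qed.

Lemma root_or_zero_inj o o' :
  absK (root_or_zero o - root_or_zero o') < 1 -> o = o'.
Proof.
case: o o' => [i|] [j|] //=.
- by move=> /gammaX_dist ij; congr Some; apply/val_inj/ij.
- by rewrite subr0 absval_gammaX ltxx.
- by rewrite sub0r absvalN// absval_gammaX ltxx.
Qed.

(** Zero and the [p^f - 1] powers of [gamma] are pairwise incongruent, and there are at most [p^f]
    residue classes. *)
Lemma residue_gammaX x : absK x <= 1 ->
  absK x < 1 \/ exists i, absK (x - gamma ^+ i) < 1.
Proof.
move=> x1; have [h hP] := residue_index.
have hg_inj : injective (h \o root_or_zero).
  move=> o o' /= /(hP _ _ (root_or_zero_le1 o) (root_or_zero_le1 o')).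
  exact: root_or_zero_inj.
have cardle :
    (#|{ffun 'I_f -> 'I_p}| <= #|{: option 'I_n}|)%N.
  by rewrite card_option card_ffun !card_ord /n prednK// expn_gt0 prime_gt0.
have /codomP[c xc] := inj_card_onto hg_inj cardle (h x).
have := (hP x _ x1 (root_or_zero_le1 c)).1 xc; case: c xc => [i|] _ /=.
  by right; exists i.
by rewrite subr0; left.
Qed.

Definition gamma_comb (m : nat) := @digit_comb m (fun j => gamma ^+ j).

Lemma gamma_comb_le1 m (d : {ffun 'I_m -> 'I_p}) : absK (gamma_comb d) <= 1.
Proof.
apply: (ultra_le_sum absK_absval ultra) => // i _.
by rewrite absvalZ absval_gammaX mulr1; exact: padic_abs_nat_le1 p_prime Qp_completion _.
Qed.

(* A nontrivial relation among the residues of [1, gamma, .., gamma^(f-1)] would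
   express all the [p^f] residues with fewer than [f] digits. *)
Lemma gamma_comb_inj (d d' : {ffun 'I_f -> 'I_p}) :
  absK (gamma_comb d - gamma_comb d') < 1 -> d = d'.
Proof.
move=> dd'; apply/eqP/negPn/negP => ne.
have [m0 m0P] : exists i, d i != d' i.
  apply/existsP; rewrite -negb_forall; apply: contraNN ne => /forallP H.
  by apply/eqP/ffunP => i; apply/eqP.
(* At the last index [m] with different digits the relation has a unit coefficient, and later
   coefficients vanish; so [gamma^m] reduces to lower powers. *)
case: (@arg_maxnP _ m0 (fun i => d i != d' i) (@nat_of_ord f) m0P) => m /= mP mmax.
pose P (x : K) := exists2 c : 'I_m -> Qp, (forall j, absp (c j) <= 1) &
  absK (x - \sum_(j < m) c j *: gamma ^+ j) < 1.
have PD x y : P x -> P y -> P (x + y).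
  move=> [c c1 xc] [c' c'1 yc']; exists (fun j => c j + c' j).
    by move=> j; exact: (ultra_leD absp_ultra).
  under eq_bigr do rewrite scalerDl.
  by rewrite big_split /= opprD addrACA (ultra_ltD ultra).
have PZ a x : absp a <= 1 -> P x -> P (a *: x).
  move=> a1 [c c1 xc]; exists (fun j => a * c j).
    by move=> j; rewrite (absvalM absp_av) mulr_ile1 ?absval_ge0.
  under eq_bigr do rewrite -scalerA.
  rewrite -scaler_sumr -scalerBr absvalZ.
  by rewrite (le_lt_trans _ xc)// ler_piMl// absval_ge0.
have Psmall x : absK x < 1 -> P x.
  move=> x1; exists (fun=> 0) => [j|]; first by rewrite absval0.
  by rewrite big1 ?subr0// => j _; rewrite scale0r.
have Psum (I : finType) (F : I -> K) : (forall i, P (F i)) -> P (\sum_i F i).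
  move=> PF; elim/big_ind : _ => //; first by apply: Psmall; rewrite absval0.
have Plow (j : nat) : (j < m)%N -> P (gamma ^+ j).
  move=> jm; exists (fun i => (i == Ordinal jm)%:R) => [i|].
    by case: eqP => _; rewrite ?absval1 ?absval0.
  rewrite (bigD1 (Ordinal jm))//= eqxx scale1r big1 ?addr0 ?subrr ?absval0// => i /negbTE ->.
  by rewrite scale0r.
pose c (j : 'I_f) : Qp := (d j)%:R - (d' j)%:R.
have c1 j : absp (c j) <= 1.
  by apply: (ultra_leB absp_av absp_ultra);
    exact: padic_abs_nat_le1 p_prime Qp_completion _.
have cm : absp (c m) = 1.
  apply/eqP; rewrite eq_le c1 leNgt; apply/negP => /digit_dist_lt1 dm.
  by rewrite dm eqxx in mP.
have cm0 : c m != 0 by rewrite -(absval_eq0 absp_av) cm oner_eq0.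
have Pm : P (gamma ^+ m).
  have dE : gamma_comb d - gamma_comb d' = \sum_(j < f) c j *: gamma ^+ j.
    by rewrite /gamma_comb /digit_comb -sumrB; apply: eq_bigr => j _; rewrite scalerBl.
  have -> : gamma ^+ m = (c m)^-1 *: ((gamma_comb d - gamma_comb d') +
      - 1 *: \sum_(j < f | j != m) c j *: gamma ^+ j).
    by rewrite dE (bigD1 m)//= scaleN1r addrK scalerA mulVf// scale1r.
  apply: (PZ); first by rewrite (absvalV absp_av) cm invr1.
  apply: PD; first exact: (Psmall).
  apply: (PZ); first by rewrite absvalN// absval1.
  rewrite big_mkcond; apply: (Psum) => j; case: eqVneq => [_|jm] /=.
    by apply: Psmall; rewrite absval0.
  have [jltm|mltj|] := ltngtP j m; first by apply: PZ => //; exact: Plow.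
    apply: Psmall; have /eqP djd'j : d j == d' j.
      by apply/negPn/negP => /mmax; rewrite leqNgt mltj.
    by rewrite /c djd'j subrr scale0r absval0.
  by move=> /val_inj jm'; rewrite jm' eqxx in jm.
have Ple (j : nat) : (j <= m)%N -> P (gamma ^+ j).
  by rewrite leq_eqVlt => /orP[/eqP ->|/Plow].
(* Multiplication by [gamma] raises the lower powers to exponents at most [m], which are already
   reducible. *)
have PX i : P (gamma ^+ i).
  elim: i => [|i [c' c'1 ic']]; first exact: Ple.
  have -> : gamma ^+ i.+1 = gamma * (gamma ^+ i - \sum_(j < m) c' j *: gamma ^+ j) +
      \sum_(j < m) c' j *: gamma ^+ j.+1.
    rewrite mulrBr -exprS mulr_sumr.
    under [X in _ - X]eq_bigr do rewrite -scalerAr -exprS.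
    by rewrite subrK.
  apply: PD; first by apply: Psmall; rewrite absM absval_gamma mul1r.
  by apply: Psum => j; apply: PZ => //; exact: Ple.
have Pall x : absK x <= 1 -> P x.
  move=> /residue_gammaX[/Psmall//|[i xi]].
  by rewrite -(subrK (gamma ^+ i) x); apply: PD => //; exact: Psmall.
have Pdig x : absK x <= 1 -> exists hh : {ffun 'I_m -> 'I_p}, absK (x - gamma_comb hh) < 1.
  move=> /Pall[c' c'1 xc'].
  have [hh _ c'h] := @digit_comb_exists m (fun j => gamma ^+ j) c'
    (fun j => eq_ind_r (fun x => x <= 1) (lexx 1) (absval_gammaX j)) c'1.
  by exists hh; exact: ultra_lt_dist_trans xc' c'h.
have /choice[w wP] : forall o, exists hh : {ffun 'I_m -> 'I_p},
    absK (root_or_zero o - gamma_comb hh) < 1.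
  by move=> o; apply: Pdig; exact: root_or_zero_le1.
have w_inj : injective w.
  move=> o o' ww; apply: root_or_zero_inj.
  by apply: (ultra_lt_dist_trans ultra (wP o)); rewrite ww absC; exact: wP.
(* Here [p^f] incongruent elements are coded by [p^m] digit vectors, although [m < f]. *)
have := leq_card w w_inj.
rewrite card_option card_ffun !card_ord /n prednK ?expn_gt0 ?prime_gt0//.
by rewrite leq_exp2l ?prime_gt1// leqNgt ltn_ord.
Qed.

(** The [p^f] digit vectors give incongruent combinations, which must exhaust the residue
    classes. *)
Lemma gamma_comb_exists x : absK x <= 1 ->
  exists d : {ffun 'I_f -> 'I_p}, absK (x - gamma_comb d) < 1.
Proof.
move=> x1; have [h hP] := residue_index.
have hg_inj : injective (fun d : {ffun 'I_f -> 'I_p} => h (gamma_comb d)).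
  by move=> d d' /(hP _ _ (gamma_comb_le1 d) (gamma_comb_le1 d'))/gamma_comb_inj.
have /codomP[d xd] := injF_onto hg_inj (h x).
by exists d; apply/(hP x _ x1 (gamma_comb_le1 d)).
Qed.

End ResidueField.

(** * Coordinates in the products [gamma^j beta^i], and the floor *)

Section Coordinates.
Variables (e f : nat) (rho : R) (gamma beta : K).
Hypothesis ramK : ramification_index absK {: K} e.
Hypothesis resK : residue_degree absp absK {: K} f.
Hypothesis gamma_prim : (p ^ f).-1.-primitive_root gamma.
Hypothesis rho01 : 0 < rho < 1.
Hypothesis rho_e : rho ^+ e = p%:R^-1.
Hypothesis abs_beta : absK beta = rho^-1.

Let rho_gt0 : 0 < rho. Proof. by case/andP: rho01. Qed.
Let rho_lt1 : rho < 1. Proof. by case/andP: rho01. Qed.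
Let e_gt0 : (0 < e)%N. Proof. exact: ramification_index_gt0 ramK. Qed.
Let value_group := ext_value_group ramK rho01 rho_e abs_beta.
Let abs_betaX := absval_beta_exp abs_beta.

Lemma absval_lt_le x (k : int) : absK x < rho ^ k -> absK x <= rho ^ (k + 1).
Proof.
have [->|x0] := eqVneq x 0; first by rewrite absval0// exprz_ge0// ltW.
have [l ->] := value_group x0.
by rewrite ltNge !ler_exprz_lt1// -ltNge; lia.
Qed.

(** After division by a largest coefficient, a sum of absolute value less than 1 would round to a
    digit combination congruent to 0. By [gamma_comb_inj] all its digits vanish, but one coefficient
    has become 1. The argument [j] guarantees that the row is not empty. *)
Lemma gamma_row_abs (c : 'I_f -> Qp) (j : 'I_f) : exists j0,
  (forall j, absp (c j) <= absp (c j0)) /\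
  absK (\sum_(j < f) c j *: gamma ^+ j) = absp (c j0).
Proof.
case: (@Order.TotalTheory.arg_maxP _ _ _ j xpredT (absp \o c) isT) => m _ /= mmax.
have cm i : absp (c i) <= absp (c m) by exact: mmax.
exists m; split=> //; have [cm0|cm0] := eqVneq (c m) 0.
  rewrite cm0 absval0// big1 ?absval0// => i _.
  have /eqP : absp (c i) == 0 by rewrite eq_le absval_ge0// andbT -(absval0 absp_av) -cm0.
  by move=> /eqP; rewrite (absval_eq0 absp_av) => /eqP ->; rewrite scale0r.
pose a i := c i / c m.
have am : a m = 1 by rewrite /a divff.
have acm : 0 < absp (c m) by rewrite absval_gt0.
have a1 i : absp (a i) <= 1.
  by rewrite /a (absvalM absp_av) (absvalV absp_av) ler_pdivrMr// mul1r.
have -> : \sum_(j < f) c j *: gamma ^+ j = c m *: \sum_(j < f) a j *: gamma ^+ j.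
  rewrite scaler_sumr; apply: eq_bigr => i _.
  by rewrite scalerA /a mulrC divfK.
rewrite absvalZ -[RHS]mulr1; congr (_ * _).
have g1 i : absK (gamma ^+ i) <= 1 by rewrite (absval_gammaX gamma_prim).
apply/eqP; rewrite eq_le; apply/andP; split.
  apply: (ultra_le_sum absK_absval ultra) => // i _.
  by rewrite absvalZ mulr_ile1 ?absval_ge0.
rewrite leNgt; apply/negP => lt1.
have [d ad dlt] := @digit_comb_exists f (fun j => gamma ^+ j) a g1 a1.
have d0 : d = [ffun=> Ordinal (prime_gt0 p_prime)].
  apply: (gamma_comb_inj resK gamma_prim).
  have -> : gamma_comb gamma ([ffun=> Ordinal (prime_gt0 p_prime)] : {ffun 'I_f -> 'I_p}) = 0.
    by apply: big1 => i _; rewrite ffunE scale0r.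
  by have := ultra_ltB absK_absval ultra lt1 dlt; rewrite opprB addrC subrK subr0.
by have := ad m; rewrite am d0 ffunE subr0 absval1// ltxx.
Qed.

Lemma lincomb_rows (b : 'M[Qp]_(e, f)) : lincomb gamma beta b =
  \sum_(i < e) (\sum_(j < f) b i j *: gamma ^+ j) * beta ^+ i.
Proof.
apply: eq_bigr => i _; rewrite mulr_suml; apply: eq_bigr => j _.
by rewrite scalerAl.
Qed.

Lemma lincomb0 : @lincomb Qp K e f gamma beta 0 = 0.
Proof. by apply: big1 => i _; apply: big1 => j _; rewrite mxE scale0r. Qed.

Lemma lincombB (b b' : 'M[Qp]_(e, f)) :
  lincomb gamma beta (b - b') = lincomb gamma beta b - lincomb gamma beta b'.
Proof.
rewrite /lincomb -sumrB; apply: eq_bigr => i _; rewrite -sumrB.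
by apply: eq_bigr => j _; rewrite !mxE scalerBl.
Qed.

Lemma lincombD (b b' : 'M[Qp]_(e, f)) :
  lincomb gamma beta (b + b') = lincomb gamma beta b + lincomb gamma beta b'.
Proof.
rewrite /lincomb -big_split; apply: eq_bigr => i _; rewrite -big_split.
by apply: eq_bigr => j _; rewrite !mxE scalerDl.
Qed.

(* Distinct powers [beta^i] with [i < e] have absolute values in distinct classes
   modulo [|Qp^*|], so no cancellation occurs between rows. *)
Lemma coord_le_lincomb (b : 'M[Qp]_(e, f)) i j :
  absp (b i j) <= absK (lincomb gamma beta b).
Proof.
rewrite lincomb_rows; pose s i := \sum_(j < f) b i j *: gamma ^+ j.
have sv i' : s i' != 0 -> exists k : int, absK (s i') = rho ^ (e%:Z * k).
  have [j0 [_ sE]] := gamma_row_abs (b i') j.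
  rewrite -(absval_eq0 absK_absval) sE absval_eq0// => /(padic_abs_rho rho_e).
  exact.
apply: (le_trans _ (ultra_distinct_le_sum absK_absval ultra _ i)).
  have [j0 [jmax sE]] := gamma_row_abs (b i) j.
  rewrite absM sE (le_trans (jmax j))// ler_peMr ?absval_ge0// abs_betaX.
  by rewrite -(expr0z rho) ler_exprz_lt1//; lia.
move=> k l; rewrite !mulf_eq0 !negb_or => /andP[/sv[u su] _] /andP[/sv[w sw] _].
rewrite !absM su sw !abs_betaX -!expfzDr ?gt_eqF// => /(exprz_rho_inj rho01) E.
apply/val_inj => /=; have := ltn_ord k; have := ltn_ord l.
by case: (ltrgtP u w) => [uw|uw|uw]; nia.
Qed.

(** The factor [rho^(1 - e)] is [|beta|^(e - 1)], the largest absolute value among the basis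
    elements. *)
Lemma lincomb_le (b : 'M[Qp]_(e, f)) (r : R) : 0 <= r ->
  (forall i j, absp (b i j) <= r) ->
  absK (lincomb gamma beta b) <= r * rho ^ (1 - e%:Z).
Proof.
move=> r0 br; have r'0 : 0 <= r * rho ^ (1 - e%:Z) by rewrite mulr_ge0// exprz_ge0// ltW.
apply: (ultra_le_sum absK_absval ultra) => // i _.
apply: (ultra_le_sum absK_absval ultra) => // j _.
rewrite absvalZ absM (absval_gammaX gamma_prim) mul1r abs_betaX.
rewrite ler_pM ?absval_ge0//; first by rewrite exprz_ge0// ltW.
by rewrite ler_exprz_lt1//; have := ltn_ord i; lia.
Qed.

(** Coordinates smaller than 1 are at most [1/p = rho^e], which leaves [rho] after multiplication by
    [rho^(1 - e)]. *)
Lemma lincomb_lt1 (b : 'M[Qp]_(e, f)) : (forall i j, absp (b i j) < 1) ->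
  absK (lincomb gamma beta b) < 1.
Proof.
move=> b1; have /lincomb_le : forall i j, absp (b i j) <= rho ^+ e.
  by move=> i j; rewrite rho_e -(padic_abs_lt1 p_prime Qp_completion).
move=> /(_ (exprn_ge0 _ (ltW rho_gt0)))/le_lt_trans; apply.
rewrite exprnP -expfzDr ?gt_eqF// addrCA subrr addr0 expr1z//.
Qed.

Lemma lincomb_approx x (k : int) : absK x <= rho ^ k ->
  exists b, absK (x - @lincomb Qp K e f gamma beta b) <= rho ^ (k + 1).
Proof.
(* Division of [-k] by [e] gives [k = e q - i0] with [0 <= i0 < e], so [p^q beta^i0] has absolute
   value exactly [rho^k]. The residue of [x] divided by it supplies the digits of one row. *)
move=> xk; pose i0 := (- k %% e)%Z; pose q := - (- k %/ e)%Z.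
have ez : (e%:Z : int) != 0 by rewrite eqz_nat -lt0n.
have i0ge : 0 <= i0 by exact: modz_ge0.
have i0lt : i0 < e%:Z by rewrite ltz_pmod// ltz_nat.
have kE : k = e%:Z * q - i0.
  by have := divz_eq (- k) e; rewrite -/i0 /q; nia.
have i0lt' : (`|i0| < e)%N by rewrite -ltz_nat gez0_abs.
pose i : 'I_e := Ordinal i0lt'.
have iE : (i : nat)%:Z = i0 by rewrite /= gez0_abs.
have pQ : p%:R != 0 :> Qp.
  by rewrite -(absval_eq0 absp_av) (padic_abs_p p_prime Qp_completion) invr_eq0 gt_eqF.
pose w := p%:R ^ q *: beta ^+ i.
have wabs : absK w = rho ^ k.
  rewrite absvalZ (absvalXz absp_av) (padic_abs_p p_prime Qp_completion) -rho_e.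
  by rewrite abs_betaX iE exprnP exprz_exp -expfzDr ?gt_eqF// kE.
have w0 : w != 0 by rewrite -(absval_eq0 absK_absval) wabs expfz_neq0// gt_eqF.
have xw : absK (x / w) <= 1.
  by rewrite absM absV wabs ler_pdivrMr ?exprz_gt0// mul1r.
have [d xd] := gamma_comb_exists resK gamma_prim xw.
pose b : 'M[Qp]_(e, f) := \matrix_(i', j) (if i' == i then (d j)%:R * p%:R ^ q else 0).
have bE : lincomb gamma beta b = w * gamma_comb gamma d.
  rewrite lincomb_rows (bigD1 i)//= [X in _ + X]big1 ?addr0; last first.
    move=> i' /negbTE i'i; rewrite big1 ?mul0r// => j _.
    by rewrite !mxE i'i scale0r.
  have -> : \sum_(j < f) b i j *: gamma ^+ j = p%:R ^ q *: gamma_comb gamma d.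
    rewrite /gamma_comb /digit_comb scaler_sumr; apply: eq_bigr => j _.
    by rewrite !mxE eqxx scalerA mulrC.
  by rewrite -!scalerAl mulrC.
exists b; apply: absval_lt_le.
have -> : x - lincomb gamma beta b = w * (x / w - gamma_comb gamma d).
  by rewrite bE mulrBr mulrCA divff// mulr1.
by rewrite absM wabs gtr_pMr ?exprz_gt0.
Qed.

Lemma cvg_exprz_rho0 (c : R) (k : int) : c * rho ^ (k + n%:Z) @[n --> \oo] --> 0.
Proof.
have -> : (fun n : nat => c * rho ^ (k + n%:Z)) = (fun n => (c * rho ^ k) * rho ^+ n).
  by apply/funext => n; rewrite expfzDr ?gt_eqF// mulrA.
rewrite -[X in _ --> X](mulr0 (c * rho ^ k)); apply: cvgMr.
by apply: cvg_expr; rewrite ger0_norm// ltW.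
Qed.

(* The combinations of the [gamma^j beta^i] form a complete, hence closed,
   subspace in which every point of [K] can be approximated. *)
Lemma lincomb_surj x : exists b, x = @lincomb Qp K e f gamma beta b.
Proof.
have [->|x0] := eqVneq x 0.
  by exists 0; rewrite lincomb0.
have [k xk] := value_group x0.
have /choice[g gP] : forall ky : int * K, exists b, absK ky.2 <= rho ^ ky.1 ->
    absK (ky.2 - @lincomb Qp K e f gamma beta b) <= rho ^ (ky.1 + 1).
  move=> [l y] /=; have [yl|yl] := boolP (absK y <= rho ^ l); last by exists 0.
  by have [b yb] := lincomb_approx yl; exists b.
pose step n b := b + g (k + n%:Z, x - lincomb gamma beta b).
pose u := fix u n := if n is n'.+1 then step n' (u n') else 0 : 'M[Qp]_(e, f).
have uP n : absK (x - lincomb gamma beta (u n)) <= rho ^ (k + n%:Z).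
  elim: n => [|n IH].
    by rewrite /= lincomb0 subr0 addr0 xk.
  rewrite /= /step lincombD opprD addrA.
  have -> : k + n.+1%:Z = k + n%:Z + 1 by lia.
  exact: gP (k + n%:Z, _) IH.
(* Coordinates are bounded by the absolute value of the combination, so each of them forms a Cauchy
   sequence in [Qp]. *)
have u_dist m n i j : (m <= n)%N -> absp (u m i j - u n i j) <= rho ^ (k + m%:Z).
  move=> mn; have := coord_le_lincomb (u m - u n) i j; rewrite !mxE => /le_trans; apply.
  rewrite lincombB; apply: (ultra_le_dist_trans ultra (y := x)); first by rewrite absC.
  by rewrite (le_trans (uP n))// ler_exprz_lt1//; lia.
have [_ _ _ complete] := Qp_completion.
have /choice[b0 b0P] : forall ij : 'I_e * 'I_f, exists y : Qp,
    (fun n => absp (u n ij.1 ij.2 - y)) @ \oo --> (0 : R).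
  move=> [i j]; apply: complete => eps eps0.
  have /cvgr0Pnorm_lt/(_ _ eps0)[N _ NP] := cvg_exprz_rho0 1 k.
  exists N => m n Nm Nn; have := NP N (leqnn N).
  rewrite /= mul1r ger0_norm; last by rewrite exprz_ge0// ltW.
  apply: le_lt_trans; apply: (ultra_le_dist_trans absp_ultra (y := u N i j)).
    by rewrite (absval_distC absp_av); exact: u_dist.
  exact: u_dist.
pose b : 'M[Qp]_(e, f) := \matrix_(i, j) b0 (i, j).
have ub n i j : absp ((u n - b) i j) <= rho ^ (k + n%:Z).
  have rk : 0 < rho ^ (k + n%:Z) by rewrite exprz_gt0.
  have /cvgr0Pnorm_lt/(_ _ rk)[N _ NP] := b0P (i, j).
  have := NP (maxn n N) (leq_maxr n N); rewrite /= ger0_norm ?absval_ge0// => /ltW.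
  rewrite !mxE; apply: (ultra_le_dist_trans absp_ultra).
  by apply: u_dist; exact: leq_maxl.
exists b; apply/eqP; rewrite -subr_eq0 -(absval_eq0 absK_absval) eq_le absval_ge0// andbT.
(* [c] covers both errors: factor 1 for the approximation by [u n], and [rho^(1 - e)] for replacing
   its coordinates by their limits. *)
pose c : R := Num.max 1 (rho ^ (1 - e%:Z)).
have lim0 := cvg_exprz_rho0 c k.
rewrite -(cvg_lim _ lim0)//; apply: limr_ge; first by apply/cvg_ex; exists 0.
apply: nearW => n; have rk : 0 <= rho ^ (k + n%:Z) by rewrite exprz_ge0// ltW.
apply: (ultra_le_dist_trans ultra (y := lincomb gamma beta (u n))).
  by rewrite (le_trans (uP n))// ler_peMl// le_max lexx.
rewrite -lincombB (le_trans (lincomb_le rk (ub n)))// mulrC ler_wpM2r//.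
by rewrite le_max lexx orbT.
Qed.

Definition coords (x : K) : 'M[Qp]_(e, f) :=
  xget 0 [set b : 'M[Qp]_(e, f) | x = lincomb gamma beta b].

Lemma coordsK x : lincomb gamma beta (coords x) = x.
Proof.
rewrite /coords; have [b bx] := lincomb_surj x.
by case: xgetP => [y _ ->//|/(_ b)].
Qed.

Let fl := cf_floor p absp e f gamma beta.

Lemma cf_floorE x : fl x = lincomb gamma beta (map_mx (padic_floor p absp) (coords x)).
Proof. by []. Qed.

Lemma cf_floor_dist x : absK (x - fl x) < 1.
Proof.
rewrite cf_floorE -{1}(coordsK x) -lincombB; apply: lincomb_lt1 => i j.
by rewrite !mxE; case: (padic_floor_spec p_prime Qp_completion (coords x i j)).
Qed.

(** The coordinates of [x - y] are bounded by its absolute value, so corresponding coordinates have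
    the same p-adic floor. *)
Lemma cf_floor_eq x y : absK (x - y) < 1 -> fl x = fl y.
Proof.
move=> xy; rewrite !cf_floorE; congr (lincomb _ _ _); apply/matrixP => i j.
rewrite !mxE; apply: padic_floor_eq => //.
have := coord_le_lincomb (coords x - coords y) i j.
by rewrite lincombB !coordsK !mxE => /le_lt_trans; apply.
Qed.

(** Each coordinate of a floor has the form [l / p^N], so a floor is determined by a matrix of pairs
    of natural numbers. *)
Lemma cf_floor_countable : exists idx : K -> nat,
  forall x y, idx (fl x) = idx (fl y) -> fl x = fl y.
Proof.
pose q (z : nat * nat) : Qp := z.2%:R / p%:R ^+ z.1.
have /choice[Q QP] : forall x : K, exists M : 'M[(nat * nat)%type]_(e, f),
    fl x = lincomb gamma beta (map_mx q M).
  move=> x.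
  have /choice[w wP] : forall ij : 'I_e * 'I_f, exists z : nat * nat,
      padic_floor p absp (coords x ij.1 ij.2) = q z.
    move=> [i j]; have [_ [N [l [_ ->]]]] :=
      padic_floor_spec p_prime Qp_completion (coords x i j).
    by exists (N, l).
  exists (\matrix_(i, j) w (i, j)); rewrite cf_floorE; congr (lincomb _ _ _).
  by apply/matrixP => i j; rewrite !mxE (wP (i, j)).
have /choice[idx idxP] : forall y : K, exists n : nat, forall x : K, y = fl x ->
    exists2 M : 'M[(nat * nat)%type]_(e, f), pickle M = n &
      y = lincomb gamma beta (map_mx q M).
  move=> y; have [[x ->]|nox] := pselect (exists x, y = fl x).
    by exists (pickle (Q x)) => _ _; exists (Q x).
  by exists 0%N => x yx; case: nox; exists x.
exists idx => x y; have [M <- ->] := idxP _ x erefl; have [M' <- ->] := idxP _ y erefl.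
by move=> /(pcan_inj pickleK) ->.
Qed.

(** * Haar measure of the balls *)

Variable mu : {measure set (borel absK) -> \bar R}.
Hypothesis mu_translate : forall (x : K) (A : set (borel absK)), measurable A ->
  mu [set (x + y : K) | y in (A : set K)] = mu A.

Lemma sume_const_seq (I : Type) (s : seq I) (c : \bar R) : (0 <= c)%E ->
  (\sum_(i <- s) c = (size s)%:R%:E * c)%E.
Proof.
move=> c0; elim: s => [|i s IH]; first by rewrite big_nil mul0e.
by rewrite big_cons IH /= -natr1 EFinD ge0_muleDl ?lee_fin// mul1e addeC.
Qed.

(** Scaling by [beta^-n], of absolute value [rho^n], carries the residue classes of integral
    elements to balls of radius [rho^(n+1)]. *)
Lemma cball_residues n : cball absK rho 0 n =
  \bigcup_(d in [set: {ffun 'I_f -> 'I_p}])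
    cball absK rho (beta ^- n * gamma_comb gamma d) n.+1.
Proof.
have wabs : absK (beta ^- n) = rho ^+ n by rewrite absV absX abs_beta exprVn invrK.
have rn : 0 < rho ^+ n by exact: exprn_gt0.
have w0 : beta ^- n != 0 by rewrite -(absval_eq0 absK_absval) wabs gt_eqF.
apply/seteqP; split => [x|x [d _]]; rewrite /cball /= subr0.
  move=> xn; have xw : absK (x / beta ^- n) <= 1.
    by rewrite absM absV wabs ler_pdivrMr// mul1r.
  have [d xd] := gamma_comb_exists resK gamma_prim xw; exists d => //=.
  have -> : x - beta ^- n * gamma_comb gamma d =
      beta ^- n * (x / beta ^- n - gamma_comb gamma d).
    by rewrite mulrBr mulrCA divff// mulr1.
  rewrite absM wabs exprSr ler_pM2l//.
  have := @absval_lt_le (x / beta ^- n - gamma_comb gamma d) 0.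
  by rewrite expr0z add0r expr1z; apply.
move=> xd; rewrite -(subrK (beta ^- n * gamma_comb gamma d) x).
rewrite (ultra_leD ultra)//.
  by rewrite (le_trans xd)// ler_wiXn2l// ltW.
by rewrite absM wabs ler_piMr ?(ltW rn)// (gamma_comb_le1 gamma_prim).
Qed.

Lemma cball_residues_disjoint n :
  trivIset [set: {ffun 'I_f -> 'I_p}]
    (fun d => cball absK rho (beta ^- n * gamma_comb gamma d) n.+1).
Proof.
have wabs : absK (beta ^- n) = rho ^+ n by rewrite absV absX abs_beta exprVn invrK.
have rn : 0 < rho ^+ n by exact: exprn_gt0.
move=> d d' _ _ [x [/= xd xd']]; apply: (gamma_comb_inj resK gamma_prim).
have : absK (beta ^- n * (gamma_comb gamma d - gamma_comb gamma d')) <= rho ^+ n.+1.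
  rewrite mulrBr; apply: (ultra_le_dist_trans ultra (y := x)) => //.
  by rewrite absC.
by rewrite absM wabs exprSr ler_pM2l// => /le_lt_trans; apply.
Qed.

(** Each ball splits into [p^f] disjoint translates of the next smaller one, starting from the unit
    ball of mass 1. *)
Lemma mu_cball_pow n : mu (unit_ball absK) = 1%E ->
  mu (cball absK rho 0 n.+1) = ((p%:R ^+ f)^-1 ^+ n)%:E.
Proof.
move=> mu1; have mcb x k : measurable (cball absK rho x k : set (borel absK)).
  exact: measurable_cball.
elim: n => [|n IH].
  by rewrite expr0 -mu1 (unit_ballE absK_absval rho01 value_group).
have q0 : 0 < p%:R ^+ f :> R by exact: exprn_gt0.
have : (mu (cball absK rho 0 n.+1) = (p%:R ^+ f)%:E * mu (cball absK rho 0 n.+2))%E.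
  have setTE : [set: {ffun 'I_f -> 'I_p}] = [set` enum {ffun 'I_f -> 'I_p}].
    by apply/seteqP; split => d //= _; rewrite mem_enum.
  rewrite cball_residues measure_fin_bigcup//; last 2 first.
  - by rewrite setTE; exact: finite_seq.
  - exact: cball_residues_disjoint.
  rewrite setTE -fsbig_seq ?enum_uniq//.
  rewrite (eq_bigr (fun=> mu (cball absK rho 0 n.+2))) => [|d _]; last first.
    exact: (mu_cball_translate ultra rho01 mu_translate).
  rewrite sume_const_seq// -cardE card_ffun !card_ord natrX//.
rewrite IH; have : (0 <= mu (cball absK rho 0 n.+2))%E by [].
(* The smaller ball cannot have infinite measure, since the larger one has finite measure. *)
case: (mu _) => [s|_|]//; last by rewrite gt0_muley// lte_fin.
by move=> _ [/esym/(canRL (mulKf (lt0r_neq0 q0))) ->]; rewrite exprS.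
Qed.

End Coordinates.
End LocalField.

(** * From depths to valuations *)

Lemma increasing_pos_seq_pred_inj (a : nat -> nat) :
  increasing_pos_seq a -> injective (fun j => (a j.+1).-1).
Proof.
move=> [a_pos a_lt] i j /= bij; have aij : a i.+1 = a j.+1.
  by rewrite -(prednK (a_pos i.+1 isT)) bij prednK// a_pos.
case: (ltngtP i j) => // ij.
  by have := a_lt i.+1 j.+1 isT ij; rewrite aij ltnn.
by have := a_lt j.+1 i.+1 isT ij; rewrite aij ltnn.
Qed.

Unset Implicit Arguments.

Theorem proposition23 (R : realType) (p : nat) (p_prime : prime p)
  (Qp : fieldType) (absp : Qp -> R) (Qp_completion : is_padic_completion p absp)
  (K : fieldExtType Qp) (m : nat) (dimK : \dim {: K} = m)
  (absK : K -> R) (absK_absval : is_absval absK)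
  (absK_ext : forall a : Qp, absK a%:A = absp a)
  (v : K -> R) (absK_v : forall x : K, x != 0 -> absK x = p%:R `^ (- v x))
  (e f : nat)
  (ramK : ramification_index absK {: K} e)
  (resK : residue_degree absp absK {: K} f)
  (L : {subfield K}) (dimL : \dim L = f) (L_unram : ramification_index absK L 1)
  (gamma : K) (gamma_prim : (p ^ f).-1.-primitive_root gamma)
  (L_gamma : L = <<1; gamma>>%VS :> {vspace K})
  (beta : K) (K_beta : fullv = <<L; beta>>%VS :> {vspace K})
  (abs_beta : absK beta = p%:R `^ (e%:R^-1))
  (mu : {measure set (borel absK) -> \bar R}) (mu_haar : is_haar mu)
  (mu_ball : mu (unit_ball absK) = 1%E)
  (a : nat -> nat) (a_good : L2_good_universal R a)
  (a_ud : forall theta : R, irrational theta ->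
     uniformly_distributed_mod1 (fun n => (a n)%:R * theta)) :
  let floorK := cf_floor p absp e f gamma beta in
  \forall alpha \ae mu, unit_ball absK alpha ->
    (forall j : nat, (0 < j)%N ->
       iter (a j).-1 (cf_map floorK) (alpha : K) != 0) /\
    ((fun n : nat => n%:R^-1 *
        \sum_(1 <= j < n.+1) (- v (partial_quotient floorK (a j) alpha)))
      @ \oo --> (p%:R ^+ f / ((p%:R ^+ f - 1) * e%:R) : R)).
Proof.
move=> floorK; have e0 := ramification_index_gt0 ramK.
have eR : e%:R != 0 :> R by rewrite pnatr_eq0 -lt0n.
have p0 : 0 < p%:R :> R by rewrite ltr0n prime_gt0.
have p1 : 1 < p%:R :> R by rewrite ltr1n prime_gt1.
have lnp : 0 < ln (p%:R : R) by rewrite ln_gt0.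
pose rho : R := p%:R `^ (- e%:R^-1).
have rho_gt0 : 0 < rho by exact: powR_gt0.
have rho_e : rho ^+ e = p%:R^-1.
  by rewrite -powR_mulrn ?ltW// -powRrM mulNr mulVf// powRN powRr1// ltW.
have rho01 : 0 < rho < 1.
  rewrite rho_gt0 ltNge; apply/negP => /(exprn_ege1 e).
  by rewrite rho_e leNgt invf_lt1// p1.
have beta_rho : absK beta = rho^-1 by rewrite abs_beta /rho powRN invrK.
have ultra := ext_ultrametric p_prime Qp_completion absK_absval absK_ext.
have vg := ext_value_group p_prime Qp_completion absK_absval absK_ext
  ramK rho01 rho_e beta_rho.
have [mu_tr _ _] := mu_haar.
have mu_b := fun n => mu_cball_pow p_prime Qp_completion absK_absval absK_ext
  ramK resK gamma_prim rho01 rho_e beta_rho mu_tr n mu_ball.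
have fl_dist := cf_floor_dist p_prime Qp_completion absK_absval absK_ext
  ramK resK gamma_prim rho01 rho_e beta_rho.
have fl_eq := cf_floor_eq p_prime Qp_completion absK_absval absK_ext
  ramK resK gamma_prim rho01 rho_e beta_rho.
have [idx idx_inj] := cf_floor_countable p_prime Qp_completion e f gamma beta.
have f0 : (0 < f)%N.
  by rewrite lt0n; apply: contraTneq (prim_order_gt0 gamma_prim) => ->.
pose q : R := p%:R ^+ f.
have q1 : 1 < q by rewrite exprn_egt1// -lt0n.
have q0 : 0 < q by exact: lt_trans q1.
have r01 : 0 <= q^-1 < 1 by rewrite invr_ge0 ltW//= invf_lt1.
(* The argument is shifted because [a] is indexed from 1, the value because the [n]-th partial
   quotient comes from the iterate [n - 1]. *)
pose b j := (a j.+1).-1.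
have b_inj : injective b := increasing_pos_seq_pred_inj a_good.1.
have [N [mN N0 sN]] := ae_average_depth absK_absval ultra rho01 vg mu_tr r01 mu_b
  fl_dist fl_eq idx_inj b_inj.
exists N; split=> // x /= nx; apply: sN; apply: contra_not nx => /= H Bx.
have {H}[d dE dlim] := H Bx.
have y0 j : iter (b j) (cf_map floorK) x != 0.
  by rewrite -(absval_gt0 absK_absval) dE exprn_gt0.
split; first by case=> // j _; exact: (y0 j).
have vE j : - v (partial_quotient floorK (a j.+1) x) = (d j)%:R / e%:R.
  rewrite /partial_quotient -/(b j); set y := iter _ _ _.
  have yn0 : y != 0 by exact: y0.
  have yV : absK y^-1 = rho ^- d j by rewrite (absvalV absK_absval) dE.
  have y1 : 1 < absK y^-1.
    rewrite (absvalV absK_absval) invf_gt1 ?(absval_gt0 absK_absval)//.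
    have : unit_ball absK y.
      rewrite /y; case: (b j) => [//|n]; rewrite iterS.
      exact: (cf_map_unit_ball absK_absval fl_dist).
    by [].
  have cabs : absK (floorK y^-1) = rho ^- d j.
    rewrite -(subrK y^-1 (floorK y^-1)) addrC (ultra_dominant absK_absval ultra)//.
    rewrite (absval_distC absK_absval); exact: lt_trans (fl_dist _) y1.
  have c0 : floorK y^-1 != 0.
    by rewrite -(absval_gt0 absK_absval) cabs invr_gt0 exprn_gt0.
  (* Both sides are real powers of [p], so logarithms identify the valuation as [- d / e]. *)
  have := absK_v _ c0; rewrite cabs => /(congr1 (@ln R)).
  rewrite ln_powR -powR_mulrn ?ltW// -powRrM -powRN ln_powR.
  by move=> /(mulIf (lt0r_neq0 lnp)) <-; rewrite mulNr opprK [RHS]mulrC.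
have limE : p%:R ^+ f / ((p%:R ^+ f - 1) * e%:R) = e%:R^-1 * (1 - q^-1)^-1 :> R.
  by rewrite -/q; field; rewrite eR gt_eqF//= subr_eq0 gt_eqF.
have cv : (fun n : nat => e%:R^-1 * (n%:R^-1 * \sum_(j < n) (d j)%:R)) @ \oo -->
    (p%:R ^+ f / ((p%:R ^+ f - 1) * e%:R) : R).
  by rewrite limE; exact: cvgMr.
have avgE : (fun n : nat => e%:R^-1 * (n%:R^-1 * \sum_(j < n) (d j)%:R)) =
    (fun n : nat => n%:R^-1 *
      \sum_(1 <= j < n.+1) - v (partial_quotient floorK (a j) x)).
  apply/funext => n; rewrite big_add1 /= big_mkord.
  rewrite [in RHS](eq_bigr (fun j : 'I_n => (d j)%:R / e%:R)) => [|j _]; last exact: vE.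
  by rewrite -mulr_suml mulrCA [e%:R^-1 * _]mulrC.
by rewrite avgE in cv.
Qed.
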